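(* Let $A$, $B$, and $C$ be C*-algebras, let $(\mathsf{X}, \varphi_{\mathsf{X}})$ be an $(A,B)$ C*-correspondence, let $(\mathsf{Y}, \varphi_{\mathsf{Y}})$ be a $(B,C)$ C*-correspondence such that $B$ acts nondegenerately on $\mathsf{Y}$, and let $\rho_C \colon C \to \mathcal{L}(\mathcal{H}_0)$ be any nondegenerate representation of $C$ on a Hilbert space $\mathcal{H}_0$. Then: (1) There are Hilbert spaces $\mathcal{H}_1,\mathcal{H}_2$ and maps $\lambda_A \colon A \to \mathcal{L}(\mathcal{H}_2)$, $\sigma_B \colon B \to \mathcal{L}(\mathcal{H}_1)$, $\tau_{\mathsf{X}} \colon \mathsf{X} \to \mathcal{L}(\mathcal{H}_1, \mathcal{H}_2)$, and $\pi_{\mathsf{Y}} \colon \mathsf{Y} \to \mathcal{L}(\mathcal{H}_0, \mathcal{H}_1)$, such that $(\lambda_A, \sigma_B, \tau_{\mathsf{X}})$ is a representation of $(\mathsf{X}, \varphi_{\mathsf{X}})$ on $(\mathcal{H}_1, \mathcal{H}_2)$ and $(\sigma_B, \rho_C, \pi_{\mathsf{Y}})$ is a representation of $(\mathsf{Y}, \varphi_{\mathsf{Y}})$ on $(\mathcal{H}_0, \mathcal{H}_1)$. (2) For every pair $((\lambda_A, \sigma_B, \tau_{\mathsf{X}}), (\sigma_B, \rho_C, \pi_{\mathsf{Y}}))$ as in (1), there is a map $\pi \colon \mathsf{X} \otimes_{\varphi_{\mathsf{Y}}} \mathsf{Y} \to \mathcal{L}(\mathcal{H}_0, \mathcal{H}_2)$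 satisfying $\pi(x \otimes y)=\tau_{\mathsf{X}}(x)\pi_{\mathsf{Y}}(y)$ for all $x\in\mathsf{X}$, $y\in\mathsf{Y}$, and such that the triple $(\lambda_A, \rho_C, \pi)$ is a representation of $(\mathsf{X} \otimes_{\varphi_{\mathsf{Y}}} \mathsf{Y}, \widetilde{\varphi_{\mathsf{X}}})$ on $(\mathcal{H}_0, \mathcal{H}_2)$. (3) The map $\pi$ from (2) is an isomorphism from $\mathsf{X} \otimes_{\varphi_{\mathsf{Y}}} \mathsf{Y}$ to $\overline{\tau_{\mathsf{X}}(\mathsf{X})\pi_{\mathsf{Y}}(\mathsf{Y})}$. (4) If in addition $\rho_C$ is also faithful, then the representation $(\lambda_A, \rho_C, \pi)$ is isometric.
   Context: $\mathcal{L}(\mathcal{H},\mathcal{H}')$ is the space of bounded linear maps between Hilbert spaces, and $\mathcal{L}(\mathcal{H})=\mathcal{L}(\mathcal{H},\mathcal{H})$. A representation of a C*-algebra on $\mathcal{H}$ is a $*$-homomorphism into $\mathcal{L}(\mathcal{H})$. Inner products of right Hilbert modules are linear in the second variable and conjugate linear in the first. $\mathcal{L}_B(\mathsf{X})$ denotes the C*-algebra of adjointable maps $\mathsf{X}\to\mathsf{X}$ of a right Hilbert $B$-module. An $(A,B)$ C*-correspondence is a pair $(\mathsf{X},\varphi)$ where $\mathsf{X}$ is a right Hilbert $B$-module and $\varphi\colon A\to\mathcal{L}_B(\mathsf{X})$ is a $*$-homomorphism. $A$ acts nondegenerately on $\mathsf{X}$ if $\varphi(A)\mathsf{X}$ (the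 linear span of the elements $\varphi(a)x$) is dense in $\mathsf{X}$. A representation of an $(A,B)$ C*-correspondence $(\mathsf{X},\varphi)$ on a pair of Hilbert spaces $(\mathcal{H},\mathcal{H}')$ is a triple $(\lambda,\rho,\pi_{\mathsf{X}})$ where $\lambda$ is a representation of $A$ on $\mathcal{H}'$, $\rho$ is a representation of $B$ on $\mathcal{H}$, and $\pi_{\mathsf{X}}\colon\mathsf{X}\to\mathcal{L}(\mathcal{H},\mathcal{H}')$ is a linear map such that for all $a\in A$, $b\in B$, $x,y\in\mathsf{X}$: $\pi_{\mathsf{X}}(\varphi(a)x)=\lambda(a)\pi_{\mathsf{X}}(x)$; $\pi_{\mathsf{X}}(xb)=\pi_{\mathsf{X}}(x)\rho(b)$; $\rho(\langle x,y\rangle_B)=\pi_{\mathsf{X}}(x)^*\pi_{\mathsf{X}}(y)$. The representation is isometric if $\pi_{\mathsf{X}}$ is an isometry. Interior tensor product: for an $(A,B)$ C*-correspondence $(\mathsf{X},\varphi_{\mathsf{X}})$ and a $(B,C)$ C*-correspondence $(\mathsf{Y},\varphi_{\mathsf{Y}})$, $\mathsf{X}\otimes_{\varphi_{\mathsf{Y}}}\mathsf{Y}$ is the right Hilbert $C$-module obtained by completing the algebraic $B$-balanced tensor product $\mathsf{X}\odot_B\mathsf{Y}$ (so $xb\otimes y=x\otimes\varphi_{\mathsf{Y}}(b)y$) with respect to the norm induced by the $C$-valued pre-inner product $\langle x_1\otimes y_1,x_2\otimes y_2\rangle_C=\langle y_1,\varphi_{\mathsf{Y}}(\langle x_1,x_2\rangle_B)y_2\rangle_C$.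 It is an $(A,C)$ C*-correspondence with left action $\widetilde{\varphi_{\mathsf{X}}}\colon A\to\mathcal{L}_C(\mathsf{X}\otimes_{\varphi_{\mathsf{Y}}}\mathsf{Y})$ determined by $\widetilde{\varphi_{\mathsf{X}}}(a)(x\otimes y)=\varphi_{\mathsf{X}}(a)x\otimes y$. $\tau_{\mathsf{X}}(\mathsf{X})\pi_{\mathsf{Y}}(\mathsf{Y})$ denotes the linear span of the operators $\tau_{\mathsf{X}}(x)\pi_{\mathsf{Y}}(y)$, $x\in\mathsf{X}$, $y\in\mathsf{Y}$, and the closure is taken in $\mathcal{L}(\mathcal{H}_0,\mathcal{H}_2)$.
   Formalization: Part (3) fails when ρ_C is not faithful, as π may have a kernel; proved instead: π has range exactly the closure, induces an isometric isomorphism of (X⊗Y)/ker π onto it, and is itself a bijection onto it iff ρ_C(⟨t,t⟩)=0 implies t=0. *)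

(* Defs.v *)
From HB Require Import structures.
From mathcomp Require Import all_boot all_order all_algebra.
From mathcomp Require Import all_classical all_reals all_analysis.
From mathcomp Require Import complex.

Set Implicit Arguments.
Unset Strict Implicit.
Unset Printing Implicit Defensive.

Import Order.TTheory GRing.Theory Num.Theory.
Import numFieldNormedType.Exports.

Local Open Scope classical_set_scope.
Local Open Scope complex_scope.
Local Open Scope ring_scope.

(* Norms of normed modules over R[i] take values in R[i]; [nrm] is the same
   norm as an element of R. *)
Definition nrm (R : realType) (V : normedModType R[i]) (x : V) : R :=
  complex.Re `|x|.

Definition lin_span (R : realType) (V : lmodType R[i]) (S : set V) : set V :=
  [set v | exists n (k : 'I_n -> R[i]) (s : 'I_n -> V),
     (forall i, S (s i)) /\ v = \sum_(i < n) k i *: s i].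

(* Complex C*-algebras, not assumed to be unital, nor nonzero. *)
HB.mixin Record isCStarAlgebra (R : realType) A & CompleteNormedModule R[i] A := {
  cmul : A -> A -> A;
  cstar : A -> A;
  cmulA : associative cmul;
  cmul_linearl : forall b, linear (cmul^~ b);
  cmul_linearr : forall a, linear (cmul a);
  cmul_norm : forall a b, `|cmul a b| <= `|a| * `|b|;
  cstarK : involutive cstar;
  cstar_conjlinear : forall k a b, cstar (k *: a + b) = k^* *: cstar a + cstar b;
  cstarM : forall a b, cstar (cmul a b) = cmul (cstar b) (cstar a);
  cstar_norm : forall a, `|cmul (cstar a) a| = `|a| ^+ 2
}.

#[short(type="cstarAlgType")]
HB.structure Definition CStarAlgebra (R : realType) :=
  {A of CompleteNormedModule R[i] A & isCStarAlgebra R A}.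

Definition cpositive (R : realType) (A : cstarAlgType R) (a : A) :=
  exists b : A, a = cmul (cstar b) b.

HB.mixin Record isHilbert (R : realType) H & CompleteNormedModule R[i] H := {
  hdot : H -> H -> R[i];
  hdot_linearr : forall x k y z, hdot x (k *: y + z) = k * hdot x y + hdot x z;
  hdot_sym : forall x y, hdot y x = (hdot x y)^*;
  hdot_norm : forall x, hdot x x = `|x| ^+ 2
}.

#[short(type="hilbertType")]
HB.structure Definition Hilbert (R : realType) :=
  {H of CompleteNormedModule R[i] H & isHilbert R H}.

HB.mixin Record isHilbertModule (R : realType) (B : cstarAlgType R) X
    & CompleteNormedModule R[i] X := {
  ract : X -> B -> X;
  mdot : X -> X -> B;
  ract_linearl : forall b, linear (ract^~ b);
  ract_linearr : forall x, linear (ract x);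
  ractA : forall x a b, ract (ract x a) b = ract x (cmul a b);
  mdot_linearr : forall x, linear (mdot x);
  mdot_ract : forall x y b, mdot x (ract y b) = cmul (mdot x y) b;
  mdot_sym : forall x y, mdot y x = cstar (mdot x y);
  mdot_pos : forall x, cpositive (mdot x x);
  mdot_norm : forall x, `|mdot x x| = `|x| ^+ 2
}.

#[short(type="hilbertModType")]
HB.structure Definition HilbertModule (R : realType) (B : cstarAlgType R) :=
  {X of CompleteNormedModule R[i] X & isHilbertModule R B X}.

(* The pair of a right Hilbert B-module and a *-homomorphism from A to its
   algebra of adjointable maps; [lact_adj] says both that [lact a] is adjointable
   and that the adjoint of [lact a] is [lact (cstar a)]. *)
Record correspondence (R : realType) (A B : cstarAlgType R) := Correspondence {
  corr_mod :> hilbertModType B;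
  lact : A -> corr_mod -> corr_mod;
  lact_linear : forall k a a' x, lact (k *: a + a') x = k *: lact a x + lact a' x;
  lactM : forall a a' x, lact (cmul a a') x = lact a (lact a' x);
  lact_adj : forall a x y, mdot (lact a x) y = mdot x (lact (cstar a) y)
}.

Definition nondegenerate_corr (R : realType) (A B : cstarAlgType R)
    (X : correspondence A B) :=
  closure (lin_span [set lact a x | a in [set: A] & x in [set: X]]) = [set: X].

(* [it_mod] is the completion of the B-balanced algebraic tensor product for the
   C-valued pre-inner product: [tens] is the canonical balanced map, it carries the
   pre-inner product to the inner product, and elementary tensors span a dense
   subspace.  Completions being unique only up to unitary equivalence, results are
   stated for an arbitrary one. *)
Record interior_tensor (R : realType) (A B C : cstarAlgType R)
    (X : correspondence A B) (Y : correspondence B C) := InteriorTensor {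
  it_mod :> correspondence A C;
  tens : X -> Y -> it_mod;
  tens_linearl : forall y, linear (tens^~ y);
  tens_linearr : forall x, linear (tens x);
  tens_balanced : forall x b y, tens (ract x b) y = tens x (lact b y);
  tens_ract : forall x y c, ract (tens x y) c = tens x (ract y c);
  tens_mdot : forall x1 y1 x2 y2,
    mdot (tens x1 y1) (tens x2 y2) = mdot y1 (lact (mdot x1 x2) y2);
  tens_dense : closure (lin_span [set tens x y | x in [set: X] & y in [set: Y]])
    = [set: it_mod];
  tens_lact : forall a x y, lact a (tens x y) = tens (lact a x) y
}.

Section BoundedOperators.
Variables (R : realType) (V W : normedModType R[i]).

Record blin := Blin {
  blin_fun :> V -> W;
  blinP : (blin_fun \in [pred f : V -> W | `[< linear f /\ continuous f >]])
}.

HB.instance Definition _ := [isSub of blin for blin_fun].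
HB.instance Definition _ := [Choice of blin by <:].

Lemma blin_submod_closed :
  submod_closed [pred f : V -> W | `[< linear f /\ continuous f >]].
Proof.
split.
  apply/asboolP; split; last by move=> x; exact: cvg_cst.
  by move=> k x y; rewrite /= scaler0 addr0.
move=> k f g /asboolP[lf cf] /asboolP[lg cg]; apply/asboolP.
split.
  move=> c x y; rewrite !fctE lf lg !scalerDr !scalerA (mulrC k) -!addrA.
  by congr (_ + _); rewrite addrCA.
by move=> x; apply: cvgD; [apply: cvgZr; exact: cf|exact: cg].
Qed.

HB.instance Definition _ := GRing.isSubmodClosed.Build R[i] (V -> W)
  [pred f : V -> W | `[< linear f /\ continuous f >]] blin_submod_closed.
HB.instance Definition _ := [SubChoice_isSubLmodule of blin by <:].

Lemma blin_is_linear (f : blin) : linear f.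
Proof. by case: f => f /= /asboolP[]. Qed.

Lemma blin_continuous (f : blin) : continuous f.
Proof. by case: f => f /= /asboolP[]. Qed.

HB.instance Definition _ (f : blin) :=
  GRing.isLinear.Build R[i] V W *:%R f (blin_is_linear f).

Lemma nrmE (U : normedModType R[i]) (x : U) : `|x| = (nrm x)%:C.
Proof. by rewrite RRe_real. Qed.

Lemma nrm_ge0 (U : normedModType R[i]) (x : U) : 0 <= nrm x.
Proof. by rewrite -lecR -nrmE normr_ge0. Qed.

Lemma nrmD (U : normedModType R[i]) (x y : U) : nrm (x + y) <= nrm x + nrm y.
Proof. by rewrite -lecR rmorphD /= -!nrmE ler_normD. Qed.

Lemma nrmZ (U : normedModType R[i]) (k : R[i]) (x : U) :
  nrm (k *: x) = complex.Re `|k| * nrm x.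
Proof.
by apply: complexI; rewrite rmorphM /= -!nrmE normrZ; congr (_ * _).
Qed.

Lemma nrm_eq0 (U : normedModType R[i]) (x : U) : nrm x = 0 -> x = 0.
Proof. by move=> x0; apply/eqP; rewrite -normr_eq0 nrmE x0. Qed.

Definition opnorm (f : blin) : R := sup [set nrm (f x) | x in [set x | nrm x <= 1]].

Lemma opnorm_has_sup (f : blin) :
  has_sup [set nrm (f x) | x in [set x | nrm x <= 1]].
Proof.
split.
  by exists (nrm (f 0)), 0 => //=; rewrite /nrm normr0 ler01.
have /linear_boundedP/pinfty_ex_gt0[M M0 fM] : bounded_near f (nbhs (0 : V)).
  by apply/linear_bounded_continuous; exact: blin_continuous.
have /RRe_real ME : M \is Num.real by exact: gtr0_real.
rewrite -ME in M0 fM.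
exists (complex.Re M) => _ [x /= x1 <-]; rewrite -lecR -nrmE.
by rewrite (le_trans (fM x))// ler_piMr ?(ltW M0)// nrmE -[leRHS]/(1%:C) lecR.
Qed.

Lemma opnormP (f : blin) (x : V) : nrm (f x) <= opnorm f * nrm x.
Proof.
have [x0|x0] := eqVneq (nrm x) 0.
  by rewrite (nrm_eq0 x0) linear0 /nrm !normr0 mulr0.
have {}x0 : 0 < nrm x by rewrite lt_neqAle eq_sym x0 nrm_ge0.
rewrite -ler_pdivrMr// mulrC.
have -> : (nrm x)^-1 * nrm (f x) = nrm (f ((nrm x)^-1%:C *: x)).
  rewrite linearZ/= nrmZ; congr (_ * _).
  by rewrite ger0_norm ?lecR ?invr_ge0 ?(ltW x0).
apply: ub_le_sup; first by case: (opnorm_has_sup f).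
exists ((nrm x)^-1%:C *: x) => //=.
rewrite nrmZ ger0_norm ?lecR ?invr_ge0 ?(ltW x0)//=.
by rewrite mulVf// gt_eqF.
Qed.

Lemma opnorm_le (f : blin) (M : R) : 0 <= M ->
  (forall x, nrm (f x) <= M * nrm x) -> opnorm f <= M.
Proof.
move=> M0 fM; apply: ge_sup; first by case: (opnorm_has_sup f).
by move=> _ [x /= x1 <-]; rewrite (le_trans (fM x))// ler_piMr.
Qed.

Lemma opnorm_ge0 (f : blin) : 0 <= opnorm f.
Proof.
apply: (le_trans (nrm_ge0 (f 0))); apply: ub_le_sup.
  by case: (opnorm_has_sup f).
by exists 0 => //=; rewrite /nrm normr0 ler01.
Qed.

Lemma opnormD (f g : blin) : (opnorm (f + g))%:C <= (opnorm f)%:C + (opnorm g)%:C.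
Proof.
rewrite -rmorphD lecR; apply: opnorm_le => [|x]; first by rewrite addr_ge0 ?opnorm_ge0.
by rewrite mulrDl (le_trans (nrmD _ _))// lerD// opnormP.
Qed.

Lemma opnormZ_le (k : R[i]) (f : blin) :
  opnorm (k *: f) <= complex.Re `|k| * opnorm f.
Proof.
have k0 : 0 <= complex.Re `|k| by rewrite -lecR RRe_real ?normr_ge0.
apply: opnorm_le; first by rewrite mulr_ge0 ?opnorm_ge0.
by move=> x; rewrite [(k *: f) x]/(k *: f x) nrmZ -mulrA ler_wpM2l ?opnormP.
Qed.

Lemma opnormZ (k : R[i]) (f : blin) :
  (opnorm (k *: f))%:C = `|k| * (opnorm f)%:C.
Proof.
have kE : `|k| = (complex.Re `|k|)%:C by rewrite RRe_real.
rewrite kE -rmorphM; congr (_%:C); apply/eqP; rewrite eq_le opnormZ_le andTb.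
have [k0|k0] := eqVneq k 0.
  by rewrite k0 normr0 mul0r opnorm_ge0.
have Rk0 : 0 < complex.Re `|k| by rewrite -ltcR -kE normr_gt0.
rewrite -ler_pdivlMl//; have := opnormZ_le k^-1 (k *: f).
rewrite scalerA mulVf// scale1r normfV kE => /le_trans; apply.
by rewrite -fmorphV/=.
Qed.

Lemma opnorm_eq0 (f : blin) : (opnorm f)%:C = 0 -> f = 0.
Proof.
move=> /complexI f0; apply: val_inj; apply/funext => x; apply: nrm_eq0.
by apply/eqP; rewrite eq_le nrm_ge0 andbT (le_trans (opnormP f x))// f0 mul0r.
Qed.

HB.instance Definition _ :=
  Lmodule_isNormed.Build R[i] blin opnormD opnormZ opnorm_eq0.

End BoundedOperators.

Lemma bcomp_subproof (R : realType) (U V W : normedModType R[i])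
    (g : blin V W) (f : blin U V) :
  (g \o f) \in [pred f : U -> W | `[< linear f /\ continuous f >]].
Proof.
apply/asboolP; split; first by move=> k x y; rewrite /= !linearP.
by move=> x; apply: continuous_comp; exact: blin_continuous.
Qed.

Definition bcomp (R : realType) (U V W : normedModType R[i])
    (g : blin V W) (f : blin U V) : blin U W := Blin (bcomp_subproof g f).

(* The adjoint T^*; it exists and is unique by the Riesz representation theorem,
   so the default value 0 plays no role. *)
Definition adj (R : realType) (H K : hilbertType R) (T : blin H K) : blin K H :=
  xget 0 [set S : blin K H | forall h k, hdot (T h) k = hdot h (S k)].

Record is_repr (R : realType) (A : cstarAlgType R) (H : hilbertType R)
    (rho : A -> blin H H) : Prop := IsRepr {
  repr_linear : linear rho;
  reprM : forall a b, rho (cmul a b) = bcomp (rho a) (rho b);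
  repr_star : forall a, rho (cstar a) = adj (rho a)
}.

Definition nondegenerate_repr (R : realType) (A : cstarAlgType R)
    (H : hilbertType R) (rho : A -> blin H H) :=
  closure (lin_span [set rho a h | a in [set: A] & h in [set: H]]) = [set: H].

Record is_corr_repr (R : realType) (A B : cstarAlgType R)
    (X : correspondence A B) (H H' : hilbertType R)
    (lam : A -> blin H' H') (rho : B -> blin H H) (pi : X -> blin H H') : Prop :=
  IsCorrRepr {
  corr_repr_left : is_repr lam;
  corr_repr_right : is_repr rho;
  corr_repr_linear : linear pi;
  corr_repr_lact : forall a x, pi (lact a x) = bcomp (lam a) (pi x);
  corr_repr_ract : forall x b, pi (ract x b) = bcomp (pi x) (rho b);
  corr_repr_mdot : forall x y, rho (mdot x y) = bcomp (adj (pi x)) (pi y)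
}.

Definition isometric (R : realType) (V W : normedModType R[i]) (f : V -> W) :=
  forall x, `|f x| = `|x|.

(* For a linear map f: the map induced by f on the Banach space quotient
   V / ker f is an isometric isomorphism onto M.  A representation of a
   correspondence whose right-hand coefficient representation is not faithful can
   have a nonzero kernel, so this is the isomorphism available in general. *)
Definition quotient_isomorphism (R : realType) (V W : normedModType R[i])
    (f : V -> W) (M : set W) :=
  range f = M /\
  forall x, nrm (f x) = inf [set nrm (x - z) | z in [set z | f z = 0]].

(* Main.v *)
Require Import Defs.
From HB Require Import structures.
From mathcomp Require Import all_boot all_order all_algebra.
From mathcomp Require Import all_classical all_reals all_analysis.
From mathcomp Require Import complex ring lra.

Set Implicit Arguments.
Unset Strict Implicit.
Unset Printing Implicit Defensive.

Import Order.TTheory GRing.Theory Num.Theory.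
Import numFieldNormedType.Exports.

Local Open Scope classical_set_scope.
Local Open Scope complex_scope.
Local Open Scope ring_scope.

(* For a representation [sigma] of [B] on [H], the form
   [<x (x) h, y (x) g> = <h, sigma <x, y> g>] on formal sums of elementary tensors is
   positive: peel off the vectors [h] one at a time by projecting onto the closure of
   [sigma(B) h], where the form is that of a single vector of [X].  Its Hilbert space
   completion carries a representation of the correspondence, and doing this for [Y]
   and then for [X] gives (1).

   For (2), [x (x) y |-> tauX x \o piY y] carries the [C]-valued form of the tensor
   product, followed by [rhoC], to the operator-valued one, so it is contractive on
   sums of elementary tensors and extends by density.  This uses that [rhoC] is
   contractive: a small self-adjoint [h] is the imaginary part of [(1 - u) / 2], up to
   sign, with [u] unitary in the unitization, so [rhoC h] is bounded uniformly; powers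
   of [h] then remove the constant.

   For (3) and (4), given [t] with [r = |pi t|], let [H] be a high power of
   [<t, t> / (r^2 (1 + e))] and [K = H (H + i)^-1].  Then [t - t K] has norm at most
   [r (1 + e)], while [pi (t K)] is small because [rhoC H] is.  Iterating these
   approximate lifts yields exact ones of nearly the same norm, so [pi] has closed
   range and induces an isometry modulo its kernel. Only the Cayley transform is used,
   no continuous functional calculus. *)

(** The usual proof that the form is positive goes through positivity of the matrix of all <x_i,
    x_j> over [B]. Cyclic subspaces replace it: over sigma(B) h a formal sum collapses to a single x
    (x) h, and <x, x> has the form b^* b. The contractivity argument is written for a positive
    functional [q] and a number [e], its value at an adjoined unit, rather than for a
    representation. It then applies also to the action of [A] on formal sums, before that action is
    known to give bounded operators. Since the algebras have no unit, inverses, square roots and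
    unitaries enter only through quasi-inverses, found as fixed points of contractions. The obstacle
    in (3) is that [t] may be much larger than [pi t], the excess lying near the kernel. One element
    K must be close to 1 where <t, t> is too large and yet small under [rhoC]. The first is the
    cutoff |b (1 - K^* K)| <= 1; the second follows from i K = H (1 - K) with 1 - K a contraction,
    which bounds |rhoC K| by |rhoC H|. *)

Lemma cvgMl0 (R : realType) (M : R) (g : nat -> R) :
  g @ \oo --> 0 -> (fun n => M * g n) @ \oo --> 0.
Proof. by move=> g0; rewrite -(mulr0 M); exact: cvgM (cvg_cst _) g0. Qed.

(** * Linearity as a property of bare functions *)

Section RawLinear.
Variables (K : pzRingType) (V W : lmodType K) (f : V -> W).
Hypothesis lf : linear f.

Lemma linear_zero : f 0 = 0.
Proof.
have /eqP := lf 1 0 0; rewrite !scale1r addr0 -subr_eq0 opprD addNKr.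
by rewrite oppr_eq0 => /eqP.
Qed.

Lemma linear_scale k x : f (k *: x) = k *: f x.
Proof. by have := lf k x 0; rewrite !addr0 linear_zero addr0. Qed.

Lemma linear_add x y : f (x + y) = f x + f y.
Proof. by have := lf 1 x y; rewrite !scale1r. Qed.

Lemma linear_opp x : f (- x) = - f x.
Proof. by rewrite -scaleN1r linear_scale scaleN1r. Qed.

Lemma linear_sub x y : f (x - y) = f x - f y.
Proof. by rewrite linear_add linear_opp. Qed.

Lemma linear_sumr I (r : seq I) (F : I -> V) :
  f (\sum_(i <- r) F i) = \sum_(i <- r) f (F i).
Proof. by apply: (big_morph f linear_add linear_zero). Qed.

End RawLinear.

(** * Sequential limits measured by the real-valued norm *)

Section Sequences.
Variables (R : realType) (V : normedModType R[i]).
Implicit Types (x y : V) (u v : nat -> V).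

Lemma nrm0 : nrm (0 : V) = 0.
Proof. by rewrite /nrm normr0. Qed.

Lemma nrmN x : nrm (- x) = nrm x.
Proof. by rewrite /nrm normrN. Qed.

Lemma nrmC x y : nrm (x - y) = nrm (y - x).
Proof. by rewrite -nrmN opprB. Qed.

Lemma nrm_le0 x : nrm x <= 0 -> x = 0.
Proof. by move=> x0; apply: nrm_eq0; apply/eqP; rewrite eq_le x0 nrm_ge0. Qed.

Lemma nrm_triangle z x y : nrm (x - y) <= nrm (x - z) + nrm (z - y).
Proof. by rewrite (le_trans _ (nrmD _ _))// addrA subrK. Qed.

Lemma nrmB_ge x y : nrm x - nrm y <= nrm (x - y).
Proof. by rewrite lerBlDr (le_trans _ (nrmD _ _))// subrK. Qed.

Lemma nrm_ball x (e : R) y : ball x e%:C y <-> nrm (x - y) < e.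
Proof. by rewrite -ball_normE /ball_/= nrmE ltcR. Qed.

(** Radii of balls are elements of [R[i]], where being positive includes being real. *)
Lemma posC_ex (e : R[i]) : 0 < e -> exists2 e' : R, 0 < e' & e = e'%:C.
Proof.
case: e => a b; rewrite ltcE /= => /andP[/eqP b0 a0].
by exists a => //; rewrite b0.
Qed.

(* Convergence of sequences through the real-valued norm, which gives access to
   the theory of real limits. *)
Definition tends u x := (fun n => nrm (u n - x)) @ \oo --> (0 : R).

Lemma tendsP u x : tends u x <->
  forall e : R, 0 < e -> exists N, forall n, (N <= n)%N -> nrm (u n - x) < e.
Proof.
rewrite /tends; split=> [/cvgrPdist_lt ux e /ux [N _ uN]|ux].
  by exists N => n /uN /=; rewrite sub0r normrN ger0_norm ?nrm_ge0.
apply/cvgrPdist_lt => e /ux [N uN]; exists N => // n /uN /=.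
by rewrite sub0r normrN ger0_norm ?nrm_ge0.
Qed.

Lemma squeeze0 (f g : nat -> R) : (forall n, 0 <= f n <= g n) ->
  g @ \oo --> 0 -> f @ \oo --> 0.
Proof.
move=> fg g0; apply: (@squeeze_cvgr _ _ _ _ (fun=> 0) g) => //; last exact: cvg_cst.
exact: nearW.
Qed.

Lemma tends_le (g : nat -> R) u x : (forall n, nrm (u n - x) <= g n) ->
  g @ \oo --> 0 -> tends u x.
Proof. by move=> ug; apply: squeeze0 => n; rewrite nrm_ge0 ug. Qed.

Lemma tends_cst x : tends (fun=> x) x.
Proof. by rewrite /tends subrr nrm0; exact: cvg_cst. Qed.

Lemma tendsD u v x y : tends u x -> tends v y ->
  tends (fun n => u n + v n) (x + y).
Proof.
move=> ux vy; apply: (@tends_le (fun n => nrm (u n - x) + nrm (v n - y))).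
  by move=> n; rewrite opprD addrACA nrmD.
by rewrite -(addr0 0); exact: cvgD ux vy.
Qed.

Lemma tendsZ (k : R[i]) u x : tends u x -> tends (fun n => k *: u n) (k *: x).
Proof.
move=> ux; apply: (@tends_le (fun n => complex.Re `|k| * nrm (u n - x))).
  by move=> n; rewrite -scalerBr nrmZ.
exact: cvgMl0.
Qed.

Lemma tendsN u x : tends u x -> tends (fun n => - u n) (- x).
Proof.
by move=> /(tendsZ (-1)); under eq_fun do rewrite scaleN1r; rewrite scaleN1r.
Qed.

Lemma tendsB u v x y : tends u x -> tends v y ->
  tends (fun n => u n - v n) (x - y).
Proof. by move=> ux /tendsN; exact: tendsD. Qed.

Lemma tends_nrm u x : tends u x -> (fun n => nrm (u n)) @ \oo --> nrm x.
Proof.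
move=> ux; apply/cvgrPdist_lt => e e0.
have /tendsP/(_ _ e0)[N uN] := ux.
exists N => // n /uN /= /le_lt_trans; apply.
rewrite ler_norml; apply/andP; split; last by rewrite [leRHS]nrmC nrmB_ge.
by rewrite lerNl opprB nrmB_ge.
Qed.

Lemma tends_nrm_le u x (M : R) : tends u x -> (forall n, nrm (u n) <= M) -> nrm x <= M.
Proof. by move=> /tends_nrm ux uM; apply: (cvgr_to_le ux); exact: nearW. Qed.

Lemma tends_unique u x y : tends u x -> tends u y -> x = y.
Proof.
move=> ux uy; apply/eqP; rewrite -subr_eq0; apply/eqP/nrm_eq0.
have := tends_nrm (tendsB ux uy); under eq_fun do rewrite subrr nrm0.
by move=> h; apply/esym/(cvg_unique _ (cvg_cst 0) h).
Qed.

Lemma closureP (S : set V) x : closure S x <->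
  forall e : R, 0 < e -> exists2 y, S y & nrm (x - y) < e.
Proof.
split=> [Sx e e0|Sx].
  have /Sx[y [Sy /nrm_ball xy]] : nbhs x (ball x e%:C) by apply: nbhsx_ballx; rewrite ltcR.
  by exists y.
move=> B /nbhs_ballP[_ /= /posC_ex[e e0 ->] xB].
by have [y Sy xy] := Sx e e0; exists y; split => //; apply/xB/nrm_ball.
Qed.

Lemma cvg_inv0 : (fun n => (n.+1%:R)^-1 : R) @ \oo --> 0.
Proof. exact: cvg_harmonic. Qed.

Lemma closure_tends (S : set V) x : closure S x <->
  exists2 u, (forall n, S (u n)) & tends u x.
Proof.
split=> [/closureP Sx|[u Su /tendsP ux]].
  have /choice[u uP] (n : nat) : exists y, S y /\ nrm (y - x) <= (n.+1%:R)^-1.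
    have [|y Sy /ltW xy] := Sx (n.+1%:R)^-1; first by rewrite invr_gt0.
    by exists y; rewrite nrmC.
  exists u => [n|]; first by case: (uP n).
  by apply: tends_le cvg_inv0 => n; case: (uP n).
apply/closureP => e /ux[N uN]; exists (u N) => //.
by rewrite nrmC uN.
Qed.

End Sequences.

Lemma cauchy_tends (R : realType) (V : completeNormedModType R[i])
    (u : nat -> V) (e : nat -> R) :
  (forall m n, (m <= n)%N -> nrm (u n - u m) <= e m) -> e @ \oo --> 0 ->
  exists2 x, tends u x & forall n, nrm (x - u n) <= e n.
Proof.
move=> ue e0.
have : cauchy (u @ \oo).
  apply/cauchyP => _ /posC_ex[d d0 ->].
  have /cvgrPdist_lt/(_ d d0)[N _ eN] := e0.
  exists (u N), N => // n /= Nn; apply/nrm_ball; rewrite nrmC.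
  rewrite (le_lt_trans (ue _ _ Nn))//.
  have := eN N (leqnn _); rewrite /= sub0r normrN; apply: le_lt_trans.
  exact: ler_norm.
move=> /cauchy_cvg/cvg_ex[x ux].
have {}ux : tends u x.
  apply/tendsP => d d0.
  have /ux[N _ uN] : nbhs x (ball x d%:C) by apply: nbhsx_ballx; rewrite ltcR.
  by exists N => n /uN /nrm_ball; rewrite nrmC.
exists x => // n.
have h : tends (fun m => u (m + n)%N - u n) (x - u n).
  apply: tendsB (tends_cst _); move/tendsP : ux => ux; apply/tendsP => d /ux[N uN].
  by exists N => m Nm; apply: uN; rewrite (leq_trans Nm)// leq_addr.
by apply: (tends_nrm_le h) => m; apply: ue; rewrite leq_addl.
Qed.

Lemma geometric_tends (R : realType) (V : completeNormedModType R[i])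
    (u : nat -> V) (M q : R) : 0 <= q < 1 ->
  (forall n, nrm (u n.+1 - u n) <= M * q ^+ n) ->
  exists2 x, tends u x & forall n, nrm (x - u n) <= M / (1 - q) * q ^+ n.
Proof.
move=> /andP[q0 q1] uM.
have M0 : 0 <= M by rewrite -[M]mulr1 -(expr0 q) (le_trans (nrm_ge0 _) (uM 0%N)).
have q1' : 0 < 1 - q by rewrite subr_gt0.
(* The exact partial geometric sum is kept, rather than its limit, so that the induction on [k]
   closes. *)
have le_step m k : nrm (u (m + k)%N - u m) <= M / (1 - q) * (q ^+ m - q ^+ (m + k)).
  elim: k => [|k IH]; first by rewrite addn0 !subrr nrm0 mulr0.
  rewrite (le_trans (nrm_triangle (u (m + k)%N) _ _))// addnS.
  rewrite (le_trans (lerD (uM _) IH))// le_eqVlt; apply/orP; left; apply/eqP.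
  by rewrite exprS; field; rewrite gt_eqF.
apply: cauchy_tends.
  move=> m n mn; rewrite -(subnKC mn) (le_trans (le_step _ _))//.
  apply: ler_wpM2l; first by rewrite divr_ge0// ltW.
  by rewrite lerBlDr lerDl exprn_ge0.
apply: cvgMl0.
by apply: cvg_expr; rewrite ger0_norm.
Qed.

(** * Bounded linear maps and linear spans *)

Section BoundedLinear.
Variable R : realType.
Implicit Types V W : normedModType R[i].

Definition bounded_by V W (f : V -> W) (M : R) := forall x, nrm (f x) <= M * nrm x.

Lemma bounded_tends V W (f : V -> W) M u x : linear f -> bounded_by f M ->
  tends u x -> tends (f \o u) (f x).
Proof.
move=> lf fM ux; apply: (@tends_le _ _ (fun n => M * nrm (u n - x))).
  by move=> n /=; rewrite -linear_sub.
exact: cvgMl0.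
Qed.

Lemma linear_bounded_continuous_nrm V W (f : V -> W) M :
  linear f -> bounded_by f M -> continuous f.
Proof.
move=> lf fM x; apply/cvgrPdist_lt => _ /posC_ex[e e0 ->].
have M1 : 0 < `|M| + 1 by rewrite ltr_wpDl.
apply/nbhs_ballP; exists (e / (`|M| + 1))%:C => /=; first by rewrite ltcR divr_gt0.
move=> y /nrm_ball xy; rewrite -linear_sub// nrmE ltcR (le_lt_trans (fM _))//.
rewrite (@le_lt_trans _ _ ((`|M| + 1) * nrm (x - y)))//; last first.
  by rewrite mulrC -ltr_pdivlMr.
by rewrite ler_wpM2r ?nrm_ge0// (le_trans (ler_norm _))// lerDl.
Qed.

Lemma blin_ex V W (f : V -> W) M : linear f -> bounded_by f M ->
  exists g : blin V W, forall x, g x = f x.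
Proof.
move=> lf fM; have fP : f \in [pred f : V -> W | `[< linear f /\ continuous f >]].
  by apply/asboolP; split => //; exact: linear_bounded_continuous_nrm fM.
by exists (Blin fP).
Qed.

Lemma blin_ext V W (f g : blin V W) : (forall x, f x = g x) -> f = g.
Proof. by move=> fg; apply: val_inj; apply/funext. Qed.

Lemma blin_bounded V W (f : blin V W) : bounded_by f (opnorm f).
Proof. exact: opnormP. Qed.

Lemma blinDE V W (f g : blin V W) x : (f + g) x = f x + g x.
Proof. by []. Qed.

Lemma blinZE V W k (f : blin V W) x : (k *: f) x = k *: f x.
Proof. by []. Qed.

Lemma nrm_blin_le V W (f : blin V W) M : 0 <= M -> bounded_by f M -> nrm f <= M.
Proof. exact: opnorm_le. Qed.

Lemma nrm_bcomp U V W (g : blin V W) (f : blin U V) :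
  nrm (bcomp g f) <= nrm g * nrm f.
Proof.
apply: nrm_blin_le; first by rewrite mulr_ge0 ?nrm_ge0.
move=> x; rewrite (le_trans (opnormP g (f x)))// -mulrA.
by apply: ler_wpM2l; [exact: opnorm_ge0|exact: opnormP].
Qed.

Lemma lin_span_sub V (S : set V) : S `<=` lin_span S.
Proof.
move=> x Sx; exists 1%N, (fun=> 1), (fun=> x); split => //.
by rewrite big_ord1 scale1r.
Qed.

Lemma lin_span0 V (S : set V) : lin_span S 0.
Proof.
by exists 0%N, (fun=> 0), (fun=> 0); split; [case|rewrite big_ord0].
Qed.

Lemma lin_span_ind V (S P : set V) : P 0 -> (forall k x y, P x -> P y -> P (k *: x + y)) ->
  S `<=` P -> lin_span S `<=` P.
Proof.
move=> P0 PD SP _ [n [k [s [Ss ->]]]].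
elim: n k s Ss => [|n IH] k s Ss; first by rewrite big_ord0.
by rewrite big_ord_recl; apply: PD; [exact/SP/Ss|exact: IH].
Qed.

Lemma lin_span_comb V (S : set V) k x y :
  lin_span S x -> lin_span S y -> lin_span S (k *: x + y).
Proof.
move=> [n [a [s [Ss ->]]]] [m [b [t [St ->]]]].
exists (n + m)%N,
  (fun i : 'I_(n + m) => match fintype.split i with inl j => k * a j | inr j => b j end),
  (fun i : 'I_(n + m) => match fintype.split i with inl j => s j | inr j => t j end).
split=> [i|]; first by case: splitP.
rewrite big_split_ord /= scaler_sumr; congr (_ + _); apply: eq_bigr => i _.
  by rewrite (unsplitK (inl i : 'I_n + 'I_m)) scalerA.
by rewrite (unsplitK (inr i : 'I_n + 'I_m)).
Qed.
End BoundedLinear.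

Lemma closure_span_comb (R : realType) (V : normedModType R[i]) (S : set V) k x y :
  closure (lin_span S) x -> closure (lin_span S) y ->
  closure (lin_span S) (k *: x + y).
Proof.
move=> /closure_tends[u uS ux] /closure_tends[v vS vy]; apply/closure_tends.
exists (fun n => k *: u n + v n); last exact: tendsD (tendsZ _ ux) vy.
by move=> n; exact: lin_span_comb.
Qed.

(** * Equality and extension by density *)

Section Extension.
Variables (R : realType) (V : normedModType R[i]) (W : completeNormedModType R[i]).

Lemma dense_eq (W' : normedModType R[i]) (S : set V) (f g : V -> W') (M N : R) :
  closure (lin_span S) = setT -> linear f -> linear g ->
  bounded_by f M -> bounded_by g N -> (forall x, S x -> f x = g x) -> f =1 g.
Proof.
move=> Sd lf lg fM gN fg x.
have span_fg y : lin_span S y -> f y = g y.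
  move: y; apply: lin_span_ind => //.
    by rewrite !linear_zero.
  by move=> k y z fgy fgz; rewrite lf lg fgy fgz.
have : closure (lin_span S) x by rewrite Sd.
move=> /closure_tends[u uS ux].
apply: (tends_unique (bounded_tends lf fM ux)).
have -> : f \o u = g \o u by apply/funext => n /=; exact/span_fg/uS.
exact: bounded_tends gN ux.
Qed.

(** Stated for a graph and not for a function: a vector can be a sum of elementary tensors in many
    ways, and the bound is what makes the value independent of the choice. *)
Lemma extend_graph (G : set (V * W)) (M : R) :
  0 <= M -> G 0 -> (forall k p q, G p -> G q -> G (k *: p + q)) ->
  (forall p, G p -> nrm p.2 <= M * nrm p.1) ->
  (forall x (e : R), 0 < e -> exists2 p, G p & nrm (x - p.1) < e) ->
  exists f : V -> W, [/\ linear f, bounded_by f M & forall p, G p -> f p.1 = p.2].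
Proof.
move=> M0 G0 GD GM Gd.
have GB p q : G p -> G q -> G (p - q).
  by move=> Gp Gq; rewrite -scaleN1r addrC; exact: GD.
(* [C] is the closure of [G]. The bound makes it single-valued; density and completeness of [W] make
   it total. *)
pose C x y := exists u : nat -> V * W,
  [/\ forall n, G (u n), tends (fst \o u) x & tends (snd \o u) y].
have C_le x y : C x y -> nrm y <= M * nrm x.
  move=> [u [uG ux uy]]; apply: (ler_cvg_to (tends_nrm uy) (cvgM (cvg_cst M) (tends_nrm ux))).
  by apply: nearW => n; exact: GM.
have C_comb k x y x' y' : C x y -> C x' y' -> C (k *: x + x') (k *: y + y').
  move=> [u [uG ux uy]] [v [vG vx vy]]; exists (fun n => k *: u n + v n); split.
  - by move=> n; exact: GD.
  - exact: tendsD (tendsZ _ ux) vx.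
  - exact: tendsD (tendsZ _ uy) vy.
have C_uniq x y y' : C x y -> C x y' -> y = y'.
  move=> Cy Cy'; apply/eqP; rewrite eq_sym -subr_eq0; apply/eqP/nrm_le0.
  by have /C_le := C_comb (-1) _ _ _ _ Cy Cy'; rewrite !scaleN1r !addNr nrm0 mulr0 addrC.
have C_ex x : exists y, C x y.
  have /choice[u uP] (n : nat) : exists p, G p /\ nrm (x - p.1) < 2^-1 ^+ n.
    by have [|p ? ?] := Gd x (2^-1 ^+ n); [rewrite exprn_gt0 ?invr_gt0|exists p].
  have ux : tends (fst \o u) x.
    apply: (@tends_le _ _ (fun n => 2^-1 ^+ n)) => [n|].
      by rewrite nrmC ltW//; case: (uP n).
    by apply: cvg_expr; rewrite ger0_norm ?invr_ge0// invf_lt1// ltr1n.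
  have h2 : 0 <= (2^-1 : R) < 1.
    by apply/andP; split; lra.
  (* The constant comes from 2^-(n+1) + 2^-n <= 2 * 2^-n. *)
  have [n|y uy _] := @geometric_tends _ W (snd \o u) (M * 2) _ h2.
    have [[Gn xn] [Gn1 xn1]] := (uP n, uP n.+1).
    rewrite (le_trans (GM _ (GB _ _ Gn1 Gn)))//= -mulrA ler_wpM2l//.
    rewrite (le_trans (nrm_triangle x _ _))// [X in X + _]nrmC.
    rewrite (le_trans (lerD (ltW xn1) (ltW xn)))// exprS.
    have : 0 <= (2^-1 : R) ^+ n by rewrite exprn_ge0// invr_ge0.
    by move: (_ ^+ n) => z z0; lra.
  by exists y, u; split => // n; case: (uP n).
have [f fC] := choice C_ex.
exists f; split => [k x y|x|p Gp].
- exact/(C_uniq _ _ _ (fC _))/C_comb.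
- exact/C_le.
- by apply: (C_uniq _ _ _ (fC _)); exists (fun=> p); split => //; exact: tends_cst.
Qed.

End Extension.

(** * The modulus on [R[i]] as a real number *)

Section Modulus.
Variable R : realType.
Implicit Types (z w : R[i]) (a b t : R).

Definition cmod z : R := @nrm R R[i]^o z.

Lemma cmodE z : `|z| = (cmod z)%:C.
Proof. exact: (@nrmE R R[i]^o). Qed.

Lemma cmod_ge0 z : 0 <= cmod z.
Proof. exact: nrm_ge0. Qed.

Lemma cmod_eq0 z : cmod z = 0 -> z = 0.
Proof. exact: (@nrm_eq0 R R[i]^o). Qed.

Lemma cmodD z w : cmod (z + w) <= cmod z + cmod w.
Proof. exact: (@nrmD R R[i]^o). Qed.

Lemma cmodM z w : cmod (z * w) = cmod z * cmod w.
Proof. by apply: complexI; rewrite rmorphM /= -!cmodE normrM. Qed.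

Lemma cmodC a : 0 <= a -> cmod a%:C = a.
Proof. by move=> a0; apply: complexI; rewrite -cmodE ger0_norm ?lecR. Qed.

Lemma cmod_conj z : cmod z^* = cmod z.
Proof. by apply: complexI; rewrite -!cmodE norm_conjC. Qed.

Lemma mul_conj z : z^* * z = (cmod z ^+ 2)%:C.
Proof. by rewrite rmorphXn /= -cmodE mulrC normCK. Qed.

Lemma nrm_scale (V : normedModType R[i]) z (x : V) : nrm (z *: x) = cmod z * nrm x.
Proof. exact: nrmZ. Qed.

Lemma posC_real z : 0 <= z -> z = (cmod z)%:C.
Proof. by move=> z0; rewrite -cmodE ger0_norm. Qed.

Lemma conjR t : (t%:C)^* = t%:C.
Proof. by rewrite conj_Creal// complex_real. Qed.

Lemma conjM z w : (z * w)^* = z^* * w^*.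
Proof. exact: rmorphM. Qed.

Lemma addConj z : z + z^* = (2 * complex.Re z)%:C.
Proof.
case: z => a b; apply/eqP; rewrite eq_complex /= subrr eqxx andbT.
by rewrite mulr_natl mulr2n.
Qed.

Lemma realcD a b : (a + b)%:C = a%:C + b%:C.
Proof. exact: rmorphD. Qed.

Lemma realcB a b : (a - b)%:C = a%:C - b%:C.
Proof. exact: rmorphB. Qed.

Lemma realcM a b : (a * b)%:C = a%:C * b%:C.
Proof. exact: rmorphM. Qed.

Lemma realcX a n : (a ^+ n)%:C = a%:C ^+ n.
Proof. exact: rmorphXn. Qed.

Lemma realc_nat n : (n%:R : R)%:C = n%:R.
Proof. exact: rmorph_nat. Qed.

Lemma cmod_nat n : cmod n%:R = n%:R.
Proof. by rewrite -realc_nat cmodC. Qed.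

Lemma nrm_half (V : normedModType R[i]) (x : V) : nrm (2^-1 *: x) = 2^-1 * nrm x.
Proof.
rewrite nrm_scale; congr (_ * _); apply: (mulfI (_ : 2 != 0)); first by rewrite pnatr_eq0.
by rewrite -{1}(cmod_nat 2) -cmodM !mulfV ?pnatr_eq0// (cmod_nat 1).
Qed.

Lemma cvg_tends_C (x : nat -> R) (l : R) : x @ \oo --> l ->
  tends (fun n => (x n)%:C : R[i]^o) l%:C.
Proof.
move=> xl; apply/tendsP => e e0; have /cvgrPdist_lt/(_ e e0)[N _ xN] := xl.
exists N => n /xN /=; rewrite distrC -[in X in _ -> X]realcB => h.
by rewrite -ltcR -nrmE normc_def /= expr0n addr0 sqrtr_sqr ltcR.
Qed.

Lemma tends_mulC (k : R[i]) (x : nat -> R[i]^o) l : tends x l ->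
  tends (fun n => k * x n : R[i]^o) (k * l).
Proof. exact: tendsZ. Qed.

Lemma tends_sum I (r : seq I) (u : I -> nat -> R[i]) (l : I -> R[i]) :
  (forall i, tends (u i : nat -> R[i]^o) (l i)) ->
  tends (fun n => \sum_(i <- r) u i n : R[i]^o) (\sum_(i <- r) l i).
Proof.
move=> ul; elim: r => [|i r IH].
  by under eq_fun do rewrite big_nil; rewrite big_nil; exact: tends_cst.
by under eq_fun do rewrite big_cons; rewrite big_cons; exact: tendsD.
Qed.

Lemma tends_ge0 (z : nat -> R[i]) (l : R[i]) :
  (forall n, 0 <= z n) -> tends (z : nat -> R[i]^o) l -> 0 <= l.
Proof.
move=> z0 zl; suff -> : l = (cmod l)%:C by rewrite lecR cmod_ge0.
apply: (tends_unique zl); have := cvg_tends_C (tends_nrm zl).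
by have -> : (fun n => (nrm (z n : R[i]^o))%:C) = z by apply/funext => n; exact/esym/posC_real.
Qed.

(* The discriminant argument behind the Cauchy-Schwarz inequality. *)
Lemma quadratic_ge0 (p a b : R) : 0 <= p -> 0 <= a -> 0 <= b ->
  (forall t, 0 <= t ^+ 2 * p * a - 2 * t * p + b) -> p <= a * b.
Proof.
move=> p0 a0 b0 h; have [a_eq0|a_neq0] := eqVneq a 0.
  rewrite a_eq0 mul0r leNgt; apply/negP => p_gt0.
  (* With [a = 0] the expression is affine in t, and its value at this point would be -1. *)
  have := h ((b + 1) / (2 * p)); rewrite a_eq0 mulr0 add0r.
  have -> : 2 * ((b + 1) / (2 * p)) * p = b + 1 by field; rewrite gt_eqF.
  by lra.
have a_gt0 : 0 < a by rewrite lt_neqAle eq_sym a_neq0.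
have := h a^-1.
have -> : a^-1 ^+ 2 * p * a - 2 * a^-1 * p + b = b - p / a by field.
by rewrite subr_ge0 ler_pdivrMr// mulrC.
Qed.

End Modulus.

(* Semi-inner products on a type whose linear structure is not assumed to satisfy
   any axiom, such as formal sums of elementary tensors. *)
Record semi_inner (R : realType) := SemiInner {
  si_car :> Type;
  si_zero : si_car;
  si_add : si_car -> si_car -> si_car;
  si_scale : R[i] -> si_car -> si_car;
  sip : si_car -> si_car -> R[i];
  sip_zeror : forall x, sip x si_zero = 0;
  sip_addr : forall x y z, sip x (si_add y z) = sip x y + sip x z;
  sip_scaler : forall k x y, sip x (si_scale k y) = k * sip x y;
  sip_sym : forall x y, sip y x = (sip x y)^*;
  sip_ge0 : forall x, 0 <= sip x x
}.

Section SemiInner.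
Variables (R : realType) (V : semi_inner R).
Implicit Types (x y z : V).

Lemma sip_addl x y z : sip (si_add y z) x = sip y x + sip z x.
Proof. by rewrite sip_sym sip_addr rmorphD /= -!sip_sym. Qed.

Lemma sip_scalel k x y : sip (si_scale k y) x = k^* * sip y x.
Proof. by rewrite sip_sym sip_scaler rmorphM /= -!sip_sym. Qed.

Definition seminorm x : R := Num.sqrt (cmod (sip x x)).

Lemma seminorm_ge0 x : 0 <= seminorm x.
Proof. exact: sqrtr_ge0. Qed.

Lemma seminorm_sqr x : seminorm x ^+ 2 = cmod (sip x x).
Proof. by rewrite sqr_sqrtr ?cmod_ge0. Qed.

Lemma sip_self x : sip x x = (seminorm x ^+ 2)%:C.
Proof. by rewrite seminorm_sqr; apply: posC_real; exact: sip_ge0. Qed.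

(** The form is nonnegative at y - t <x, y> x for every real t. The coefficient <x, y> absorbs the
    phase, so this is a real quadratic in t with linear term -2 t |<x, y>|^2. *)
Lemma cauchy_schwarz x y : cmod (sip x y) <= seminorm x * seminorm y.
Proof.
rewrite -(@ler_pXn2r _ 2)// ?nnegrE ?mulr_ge0 ?seminorm_ge0 ?cmod_ge0//.
rewrite exprMn; apply: quadratic_ge0; rewrite ?sqr_ge0// => t.
rewrite -lecR; apply: le_trans (sip_ge0 (si_add (si_scale ((- t)%:C * sip x y) x) y)) _.
rewrite !(sip_addr, sip_addl, sip_scaler, sip_scalel) (sip_sym x y) !sip_self.
rewrite conjM conjR [(- t)%:C]rmorphN /=.
set z := sip x y.
have -> : - t%:C * z * (- t%:C * z^* * (seminorm x ^+ 2)%:C) + - t%:C * z * z^* +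
   (- t%:C * z^* * z + (seminorm y ^+ 2)%:C) =
   t%:C ^+ 2 * (z^* * z) * (seminorm x ^+ 2)%:C - 2 * t%:C * (z^* * z)
     + (seminorm y ^+ 2)%:C by ring.
by rewrite mul_conj -(realcX t) -(realc_nat R 2) -!realcM -realcB -realcD lexx.
Qed.

End SemiInner.

(** * Hilbert spaces: orthogonal projection and Riesz representation *)

Section HilbertSpaces.
Variables (R : realType) (H : hilbertType R).
Implicit Types (x y z : H) (k : R[i]).

Lemma hdot_linear x : linear (hdot x : H -> R[i]^o).
Proof. by move=> k y z; exact: hdot_linearr. Qed.

Lemma hdotDr x y z : hdot x (y + z) = hdot x y + hdot x z.
Proof. exact: (linear_add (hdot_linear x)). Qed.

Lemma hdotZr k x y : hdot x (k *: y) = k * hdot x y.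
Proof. exact: (linear_scale (hdot_linear x)). Qed.

Lemma hdotBr x y z : hdot x (y - z) = hdot x y - hdot x z.
Proof. exact: (linear_sub (hdot_linear x)). Qed.

Lemma hdotNr x y : hdot x (- y) = - hdot x y.
Proof. exact: (linear_opp (hdot_linear x)). Qed.

Lemma hdot0r x : hdot x 0 = 0.
Proof. exact: (linear_zero (hdot_linear x)). Qed.

Lemma hdotDl x y z : hdot (y + z) x = hdot y x + hdot z x.
Proof. by rewrite hdot_sym hdotDr rmorphD /= -!hdot_sym. Qed.

Lemma hdotZl k x y : hdot (k *: y) x = k^* * hdot y x.
Proof. by rewrite hdot_sym hdotZr rmorphM /= -!hdot_sym. Qed.

Lemma hdotBl x y z : hdot (y - z) x = hdot y x - hdot z x.
Proof. by rewrite hdot_sym hdotBr rmorphB /= -!hdot_sym. Qed.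

Lemma hdot0l x : hdot 0 x = 0.
Proof. by rewrite hdot_sym hdot0r conjC0. Qed.

Lemma hdot_self x : hdot x x = (nrm x ^+ 2)%:C.
Proof. by rewrite hdot_norm nrmE rmorphXn. Qed.

Lemma hdot_self_ge0 x : 0 <= hdot x x.
Proof. by rewrite hdot_self lecR sqr_ge0. Qed.

Definition hilbert_semi_inner : semi_inner R :=
  SemiInner hdot0r hdotDr (fun k x y => hdotZr k x y) hdot_sym hdot_self_ge0.

Lemma seminorm_hilbert x : seminorm (x : hilbert_semi_inner) = nrm x.
Proof.
by rewrite /seminorm /= hdot_self cmodC ?sqr_ge0// sqrtr_sqr ger0_norm ?nrm_ge0.
Qed.

Lemma hdot_le x y : cmod (hdot x y) <= nrm x * nrm y.
Proof. by rewrite -!seminorm_hilbert; exact: (@cauchy_schwarz _ hilbert_semi_inner). Qed.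

Lemma hdot_extr x y : (forall z, hdot z x = hdot z y) -> x = y.
Proof.
move=> xy; apply/eqP; rewrite -subr_eq0; apply/eqP/nrm_eq0/eqP.
by rewrite -sqrf_eq0; apply/eqP/complexI; rewrite -hdot_self hdotBr xy subrr.
Qed.

Lemma tends_hdot (u v : nat -> H) x y : tends u x -> tends v y ->
  tends (fun n => hdot (u n) (v n) : R[i]^o) (hdot x y).
Proof.
move=> ux vy; apply: (@tends_le _ _
    (fun n => nrm (u n - x) * nrm (v n) + nrm x * nrm (v n - y))).
  move=> n; have -> : hdot (u n) (v n) - hdot x y =
      hdot (u n - x) (v n) + hdot x (v n - y) by rewrite hdotBl hdotBr; ring.
  by rewrite (le_trans (nrmD _ _))// lerD// hdot_le.
rewrite -(addr0 0); apply: cvgD; last exact: cvgMl0.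
by rewrite -(mul0r (nrm y)); apply: cvgM (tends_nrm vy).
Qed.

Lemma nrm_sqrB x y : nrm (x - y) ^+ 2 = nrm x ^+ 2 - 2 * complex.Re (hdot x y) + nrm y ^+ 2.
Proof.
apply: complexI; rewrite -hdot_self hdotBr !hdotBl (hdot_sym x y).
rewrite realcD realcB -addConj -!hdot_self.
by ring.
Qed.

Lemma parallelogram x y :
  nrm (x - y) ^+ 2 + nrm (x + y) ^+ 2 = 2 * (nrm x ^+ 2 + nrm y ^+ 2).
Proof.
rewrite -[in x + y](opprK y) !nrm_sqrB nrmN hdotNr.
by case: (hdot x y) => a b /=; ring.
Qed.

Lemma projection_ex (M : set H) x : M 0 -> (forall k y z, M y -> M z -> M (k *: y + z)) ->
  closure M `<=` M -> exists2 p, M p & forall m, M m -> hdot m (x - p) = 0.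
Proof.
move=> M0 MD Mcl.
pose D := [set nrm (x - m) | m in M]; pose d := inf D.
have infD : has_inf D.
  by split; [exists (nrm (x - 0)), 0|exists 0 => _ [m _ <-]; exact: nrm_ge0].
have d_le m : M m -> d <= nrm (x - m).
  by move=> Mm; apply: ge_inf; [case: infD|exists m].
have d0 : 0 <= d by apply: lb_le_inf; [case: infD|move=> _ [m _ <-]; exact: nrm_ge0].
pose e n : R := n.+1%:R^-1; have e0 n : 0 < e n by rewrite invr_gt0.
have /choice[u uP] n : exists m, M m /\ nrm (x - m) < d + e n.
  by have [_ [m Mm <-] lt_m] := inf_adherent (e0 n) infD; exists m.
(* By the parallelogram law, and since the midpoint of [u m] and [u n] is at distance at least [d]
   from [x], |u n - u m|^2 <= 4 (d + e m)^2 - 4 d^2, which is the radicand. *)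
have u_cauchy m n : (m <= n)%N ->
    nrm (u n - u m) <= Num.sqrt (8 * d * e m + 4 * e m ^+ 2).
  move=> mn; rewrite -[leLHS]ger0_norm ?nrm_ge0// -sqrtr_sqr ler_wsqrtr//.
  have [[Mm lt_m] [Mn lt_n]] := (uP m, uP n).
  have le_e : e n <= e m by rewrite lef_pV2 ?posrE// ler_nat.
  have := parallelogram (x - u m) (x - u n).
  have -> : x - u m - (x - u n) = u n - u m by rewrite opprB addrC addrA subrK.
  have -> : x - u m + (x - u n) = 2 *: (x - (2^-1 *: u m + 2^-1 *: u n)).
    rewrite scalerBr scalerDr !scalerA mulfV ?pnatr_eq0// !scale1r.
    by rewrite scaler_nat mulr2n opprD addrACA.
  have /d_le : M (2^-1 *: u m + 2^-1 *: u n).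
    by apply: (MD) => //; rewrite -[_ *: _]addr0; exact: MD.
  rewrite nrm_scale cmod_nat.
  move: (nrm (x - _)) (nrm (x - u m)) (nrm (x - u n)) (nrm (u n - u m)) lt_m lt_n
    (nrm_ge0 (x - u m)) (nrm_ge0 (x - u n)) => c a b s lt_a lt_b a0 b0 dc eq_s.
  have a2 : a ^+ 2 <= (d + e m) ^+ 2 by rewrite ler_pXn2r// ?nnegrE ?addr_ge0// ltW.
  have b2 : b ^+ 2 <= (d + e m) ^+ 2.
    by rewrite ler_pXn2r// ?nnegrE ?addr_ge0// ltW//; apply: (lt_le_trans lt_b); rewrite lerD2l.
  have c2 : d ^+ 2 <= c ^+ 2 by rewrite ler_pXn2r// ?nnegrE// (le_trans d0).
  by move: a2 b2 c2 eq_s; rewrite !exprMn !sqrrD; lra.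
have e_to0 : e @ \oo --> 0 by exact: cvg_inv0.
have [|p up _] := cauchy_tends u_cauchy.
  rewrite -sqrtr0; apply: continuous_cvg; first exact: sqrt_continuous.
  rewrite -(addr0 0); apply: cvgD; first exact: cvgMl0.
  by apply: cvgMl0; rewrite -(mulr0 0); exact: cvgM.
have Mp : M p by apply: Mcl; apply/closure_tends; exists u => // n; case: (uP n).
exists p => // m Mm.
have p_min : nrm (x - p) <= d.
  have de : (fun n => d + e n) @ \oo --> d.
    by have := cvgD (cvg_cst d) e_to0; rewrite addr0; apply.
  apply: (ler_cvg_to (tends_nrm (tendsB (tends_cst x) up)) de).
  by apply: nearW => n; case: (uP n) => _ /ltW.
(* Minimality is tested at the points p + t <m, x - p> m with t real; [quadratic_ge0] with [b = 0]
   then forces <m, x - p> to vanish. *)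
apply: cmod_eq0; apply/eqP.
rewrite -sqrf_eq0 eq_le sqr_ge0 andbT -[leRHS](mulr0 (nrm m ^+ 2)).
apply: quadratic_ge0; rewrite ?sqr_ge0// => t; rewrite addr0.
have /d_le : M (t%:C * hdot m (x - p) *: m + p) by exact: MD.
rewrite [_ + p]addrC opprD addrA => /(le_trans p_min).
rewrite -(@ler_pXn2r _ 2)// ?nnegrE ?nrm_ge0// [leRHS]nrm_sqrB hdotZr (hdot_sym m).
rewrite -mulrA [_ * _^*]mulrC mul_conj -realcM /= nrm_scale cmodM !exprMn.
have -> : cmod t%:C ^+ 2 = t ^+ 2.
  by apply: complexI; rewrite -mul_conj conjR -realcM expr2.
by move: (nrm _) (cmod _) (nrm _) => a b c; lra.
Qed.

Lemma riesz (f : H -> R[i]^o) (M : R) : linear f -> bounded_by f M ->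
  exists w, forall y, f y = hdot w y.
Proof.
move=> lf fM.
have [[x fx0]|] := pselect (exists x, f x != 0); last first.
  move=> /forallNP f0; exists 0 => y; rewrite hdot0l.
  by have /negP/negPn/eqP := f0 y.
pose Ker := [set y | f y = 0].
have Ker0 : Ker 0 by exact: linear_zero.
have KerD k y z : Ker y -> Ker z -> Ker (k *: y + z).
  by rewrite /Ker /= lf => -> ->; rewrite scaler0 addr0.
have Kercl : closure Ker `<=` Ker.
  move=> y /closure_tends[u u0 uy]; have := bounded_tends lf fM uy.
  have -> : f \o u = fun=> 0 by apply/funext => n; exact: u0.
  by move=> /(tends_unique (tends_cst _))/esym.
have [p p0 p_orth] := projection_ex x Ker0 KerD Kercl.
pose w := x - p; have fw : f w = f x by rewrite (linear_sub lf) p0 subr0.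
have ww0 : hdot w w != 0.
  apply/eqP; rewrite hdot_self => /complexI/eqP; rewrite sqrf_eq0 => /eqP/nrm_eq0 w0.
  by move: fx0; rewrite -fw w0 (linear_zero lf) eqxx.
exists ((f w / hdot w w)^* *: w) => y; rewrite hdotZl conjCK.
(* The kernel has codimension one: this combination lies in it, hence is orthogonal to [w]. *)
have Kyw : Ker (f y *: w - f w *: y).
  have fZ k z : f (k *: z) = k * f z := linear_scale lf k z.
  by rewrite /Ker /= (linear_sub lf) !fZ mulrC subrr.
have := p_orth _ Kyw.
rewrite hdot_sym => /(congr1 Num.conj); rewrite conjCK conjC0 hdotBr !hdotZr.
by move/subr0_eq => e; rewrite mulrAC -e mulfK.
Qed.

End HilbertSpaces.

(** * Adjoints of bounded operators *)

Section Adjoint.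
Variables (R : realType) (H K : hilbertType R).

Lemma adj_exists (T : blin H K) : exists S : blin K H,
  forall h k, hdot (T h) k = hdot h (S k).
Proof.
have /choice[S SP] (k : K) : exists w, forall h, hdot k (T h) = hdot w h.
  apply: (@riesz _ _ (fun h => hdot k (T h) : R[i]^o) (nrm k * opnorm T)).
    by move=> c x y; rewrite linearP hdot_linearr.
  move=> h; rewrite (le_trans (hdot_le _ _))// -mulrA.
  by apply: ler_wpM2l; [exact: nrm_ge0|exact: opnormP].
have SP' h k : hdot (T h) k = hdot h (S k) by rewrite hdot_sym SP -hdot_sym.
have lS : linear S.
  by move=> c x y; apply: hdot_extr => h; rewrite hdot_linearr -!SP' hdot_linearr.
(* |S k|^2 = <T (S k), k> <= |T| |S k| |k|, and |S k| cancels. *)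
have [k|S' S'E] := @blin_ex _ _ _ S (opnorm T) lS.
  have [->|k0] := eqVneq (nrm (S k)) 0; first by rewrite mulr_ge0 ?opnorm_ge0 ?nrm_ge0.
  have {}k0 : 0 < nrm (S k) by rewrite lt_neqAle eq_sym k0 nrm_ge0.
  rewrite -(ler_pM2r k0) -expr2 -[leLHS]cmodC ?sqr_ge0// -hdot_self -SP'.
  rewrite (le_trans (hdot_le _ _))// mulrAC ler_wpM2r ?nrm_ge0//; exact: opnormP.
by exists S' => h k; rewrite S'E.
Qed.

Lemma adjP (T : blin H K) h k : hdot (T h) k = hdot h (adj T k).
Proof.
rewrite /adj; case: xgetP => [S _ SP|nS]; first exact: SP.
by have [S SP] := adj_exists T; case: (nS S).
Qed.

Lemma adj_unique (T : blin H K) (S : blin K H) :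
  (forall h k, hdot (T h) k = hdot h (S k)) -> adj T = S.
Proof.
by move=> TS; apply: blin_ext => k; apply: hdot_extr => h; rewrite -adjP TS.
Qed.

End Adjoint.

(** The power trick that removes a constant: if y < x, then c (y / x)^(2^n) tends to 0 although it
    is at least 1. *)
Lemma power_le (R : realType) (x y c : R) : 0 <= x -> 0 <= y -> 0 <= c ->
  (forall n, x ^+ (2 ^ n) <= c * y ^+ (2 ^ n)) -> x <= y.
Proof.
move=> x0 y0 c0 h; rewrite leNgt; apply/negP => yx.
have x_gt0 : 0 < x by exact: le_lt_trans yx.
have yx0 : 0 <= y / x < 1 by rewrite divr_ge0//= ltr_pdivrMr// mul1r.
have lim0 : (fun n => c * (y / x) ^+ n) @ \oo --> 0.
  by apply: cvgMl0; apply: cvg_expr; case/andP: yx0 => ? ?; rewrite ger0_norm.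
suff : 1 <= (0 : R) by rewrite ler10.
apply: (cvgr_to_ge lim0); apply: nearW => n.
have := h n; rewrite -{1}[x ^+ _]mul1r -ler_pdivlMr ?exprn_gt0// -mulrA -expr_div_n.
move=> /le_trans; apply; apply: ler_wpM2l => //.
have /andP[a b] := yx0; rewrite ler_wiXn2l// ?ltW//.
by rewrite ltnW// ltn_expl.
Qed.

(** * C*-algebra arithmetic and the Cayley transform *)

Section CStarAlgebras.
Variables (R : realType) (A : cstarAlgType R).
Implicit Types (a b c x y : A) (k : R[i]).

Lemma cmulDl a b c : cmul (a + b) c = cmul a c + cmul b c.
Proof. exact: (linear_add (cmul_linearl c)). Qed.
Lemma cmulDr a b c : cmul a (b + c) = cmul a b + cmul a c.
Proof. exact: (linear_add (cmul_linearr a)). Qed.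
Lemma cmulBl a b c : cmul (a - b) c = cmul a c - cmul b c.
Proof. exact: (linear_sub (cmul_linearl c)). Qed.
Lemma cmulBr a b c : cmul a (b - c) = cmul a b - cmul a c.
Proof. exact: (linear_sub (cmul_linearr a)). Qed.
Lemma cmulZl k a b : cmul (k *: a) b = k *: cmul a b.
Proof. exact: (linear_scale (cmul_linearl b)). Qed.
Lemma cmulZr k a b : cmul a (k *: b) = k *: cmul a b.
Proof. exact: (linear_scale (cmul_linearr a)). Qed.
Lemma cmul0l a : cmul 0 a = 0.
Proof. exact: (linear_zero (cmul_linearl a)). Qed.
Lemma cmul0r a : cmul a 0 = 0.
Proof. exact: (linear_zero (cmul_linearr a)). Qed.

Lemma cmulNl a b : cmul (- a) b = - cmul a b.
Proof. exact: (linear_opp (cmul_linearl b)). Qed.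
Lemma cmulNr a b : cmul a (- b) = - cmul a b.
Proof. exact: (linear_opp (cmul_linearr a)). Qed.

Definition cmulE := (cmulDl, cmulDr, cmulNl, cmulNr, cmulZl, cmulZr).

Lemma cstarD a b : cstar (a + b) = cstar a + cstar b.
Proof. by have := cstar_conjlinear 1 a b; rewrite conjC1 !scale1r. Qed.
Lemma cstar0 : cstar 0 = 0 :> A.
Proof. by have /eqP := cstarD 0 0; rewrite addr0 -subr_eq0 opprD addNKr oppr_eq0 => /eqP. Qed.
Lemma cstarZ k a : cstar (k *: a) = k^* *: cstar a.
Proof. by have := cstar_conjlinear k a 0; rewrite addr0 cstar0 addr0. Qed.
Lemma cstarN a : cstar (- a) = - cstar a.
Proof. by rewrite -scaleN1r cstarZ rmorphN1 scaleN1r. Qed.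
Lemma cstarB a b : cstar (a - b) = cstar a - cstar b.
Proof. by rewrite cstarD cstarN. Qed.

Lemma nrm_cmul a b : nrm (cmul a b) <= nrm a * nrm b.
Proof. by rewrite -lecR realcM -!nrmE cmul_norm. Qed.

Lemma nrm_cstar_mul a : nrm (cmul (cstar a) a) = nrm a ^+ 2.
Proof. by apply: complexI; rewrite realcX -!nrmE cstar_norm. Qed.

Lemma nrm_cstar_le a : nrm a <= nrm (cstar a).
Proof.
have [->|a0] := eqVneq (nrm a) 0; first exact: nrm_ge0.
have {}a0 : 0 < nrm a by rewrite lt_neqAle eq_sym a0 nrm_ge0.
by rewrite -(ler_pM2r a0) -expr2 -nrm_cstar_mul nrm_cmul.
Qed.

Lemma nrm_cstar a : nrm (cstar a) = nrm a.
Proof.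
by apply/eqP; rewrite eq_le nrm_cstar_le andbT -{2}(cstarK a) nrm_cstar_le.
Qed.

Lemma tends_cmul (u v : nat -> A) x y : tends u x -> tends v y ->
  tends (fun n => cmul (u n) (v n)) (cmul x y).
Proof.
move=> ux vy; apply: (@tends_le _ _
    (fun n => nrm (u n - x) * nrm (v n) + nrm x * nrm (v n - y))).
  move=> n; have -> : cmul (u n) (v n) - cmul x y =
      cmul (u n - x) (v n) + cmul x (v n - y).
    by rewrite cmulBl cmulBr addrA subrK.
  by rewrite (le_trans (nrmD _ _))// lerD// nrm_cmul.
rewrite -(addr0 0); apply: cvgD; last exact: cvgMl0.
by rewrite -(mul0r (nrm y)); apply: cvgM (tends_nrm vy).
Qed.

Lemma tends_cstar (u : nat -> A) x : tends u x -> tends (cstar \o u) (cstar x).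
Proof.
move=> ux; apply: (@tends_le _ _ (fun n => nrm (u n - x))) => // n /=.
by rewrite -cstarB nrm_cstar.
Qed.

(** This is a^(2^n). Only these powers are used, because by the C*-identity squaring a self-adjoint
    element squares its norm exactly. *)
Definition sq n a := iter n (fun x => cmul x x) a.

Lemma sq_sa n a : cstar a = a -> cstar (sq n a) = sq n a.
Proof. by move=> aa; elim: n => //= n IH; rewrite cstarM IH. Qed.

Lemma nrm_sq n a : cstar a = a -> nrm (sq n a) = nrm a ^+ (2 ^ n).
Proof.
move=> aa; elim: n => //= n IH.
by rewrite -{1}(sq_sa n aa) nrm_cstar_mul IH -exprM expnSr.
Qed.

Lemma sq_comm n a b : cmul a b = cmul b a -> cmul (sq n a) b = cmul b (sq n a).
Proof.
by move=> ab; elim: n => //= n IH; rewrite -cmulA IH cmulA IH cmulA.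
Qed.

(** Banach's fixed point theorem started at 0, the tool for equations that stand for inverses and
    square roots in the unitization. The closed set [U] carries side conditions such as commutation
    to the solution. *)
Lemma contraction_fixpoint (f : A -> A) (U : set A) (q : R) : 0 <= q < 1 ->
  U 0 -> closure U `<=` U -> (forall x, U x -> U (f x)) ->
  (forall x y, U x -> U y -> nrm (f x - f y) <= q * nrm (x - y)) ->
  exists2 x, U x & f x = x.
Proof.
move=> q01 U0 Ucl Uf fq; pose u n := iter n f 0.
have Uu n : U (u n) by elim: n => //= n; exact: Uf.
have [n|x ux _] := geometric_tends q01 (M := nrm (u 1%N - u 0%N)) (u := u).
  elim: n => [|n IH]; first by rewrite expr0 mulr1.
  rewrite (le_trans (fq _ _ (Uu n.+1) (Uu n)))// exprS mulrCA.
  by rewrite ler_wpM2l//; case/andP: q01.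
have Ux : U x by apply: Ucl; apply/closure_tends; exists u.
exists x => //; apply: (@tends_unique _ _ (fun n => u n.+1)).
  apply: (@tends_le _ _ (fun n => q * nrm (u n - x))); last exact: cvgMl0.
  by move=> n; exact: fq.
by move/tendsP: ux => ux; apply/tendsP => e /ux[N uN]; exists N => n Nn; apply/uN/leqW.
Qed.

(* [L] plays the role of [(1 - sqrt (1 - 4 h ^ 2)) / 2]; it makes
   [1 - 2 (L - i h)] unitary in the unitization. *)
Lemma quasi_unitary_part h : cstar h = h -> nrm h <= 2 / 5 ->
  exists L : A, [/\ cstar L = L, cmul L h = cmul h L & cmul L L + cmul h h = L].
Proof.
move=> hh h25.
(* The radius 1/4 makes squaring contract by 1/4 + 1/4 = 1/2, and the ball is preserved because
   (1/4)^2 + (2/5)^2 <= 1/4. *)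
pose U := [set L : A | [/\ nrm L <= 1 / 4, cstar L = L & cmul L h = cmul h L]].
have q12 : 0 <= (2^-1 : R) < 1 by apply/andP; split; lra.
have [||||L [_ L_sa Lh] LE] :=
  @contraction_fixpoint (fun L : A => cmul L L + cmul h h) U 2^-1 q12.
- split; first by rewrite nrm0; lra.
  + exact: cstar0.
  + by rewrite cmul0l cmul0r.
- move=> L /closure_tends[u Uu uL]; split.
  + by apply: (tends_nrm_le uL) => n; case: (Uu n).
  + apply: (tends_unique (tends_cstar uL)).
    have -> // : cstar \o u = u by apply/funext => n /=; case: (Uu n).
  + apply: (tends_unique (tends_cmul uL (tends_cst h))).
    have -> : (fun n => cmul (u n) h) = (fun n => cmul h (u n)).
      by apply/funext => n; case: (Uu n).
    exact: tends_cmul (tends_cst h) uL.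
- move=> L [L4 L_sa Lh]; split.
  + have [L0 h0] := (nrm_ge0 L, nrm_ge0 h).
    rewrite (le_trans (nrmD _ _))// (le_trans (lerD (nrm_cmul _ _) (nrm_cmul _ _)))//.
    by nra.
  + by rewrite cstarD !cstarM L_sa hh.
  + by rewrite !cmulE -!cmulA Lh !cmulA Lh.
- move=> x y [x4 _ _] [y4 _ _].
  have -> : cmul x x + cmul h h - (cmul y y + cmul h h) =
      cmul x (x - y) + cmul (x - y) y.
    by rewrite cmulBr cmulBl addrA subrK opprD addrACA subrr addr0.
  rewrite (le_trans (nrmD _ _))// (le_trans (lerD (nrm_cmul _ _) (nrm_cmul _ _)))//.
  by have := nrm_ge0 (x - y); nra.
- by exists L.
Qed.

(** * Positive functionals [q] with value [e] at an adjoined unit *)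

Section PositiveForm.
Variables (q : A -> R[i]^o) (e : R).
Hypotheses (lq : linear q) (q_star : forall a, q (cstar a) = (q a)^*)
  (q_ge0 : forall a, 0 <= q (cmul (cstar a) a))
  (q_ge0_1 : forall a, 0 <= e%:C + q a + q (cstar a) + q (cmul (cstar a) a)).

Let qD a b : q (a + b) = q a + q b. Proof. exact: linear_add. Qed.
Let qN a : q (- a) = - q a. Proof. exact: linear_opp. Qed.
Let qZ k a : q (k *: a) = k * q a. Proof. exact: linear_scale. Qed.

Lemma positive_form_e : 0 <= e.
Proof.
have := q_ge0_1 0; have q0 : q 0 = 0 := linear_zero lq.
by rewrite cstar0 cmul0l !q0 !addr0 lecR.
Qed.

(** Cauchy-Schwarz between [a] and the adjoined unit: [q_ge0_1] is positivity at (1 + a)^* (1 + a),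
    here used at the multiples -t (q a)^* a of [a]. *)
Lemma positive_form_cs a : cmod (q a) ^+ 2 <= e * cmod (q (cmul (cstar a) a)).
Proof.
rewrite mulrC; apply: quadratic_ge0; rewrite ?sqr_ge0 ?cmod_ge0 ?positive_form_e//.
move=> t; rewrite -lecR; set z := q a.
apply: le_trans (q_ge0_1 (((- t)%:C * z^*) *: a)) _.
rewrite cstarZ cmulZl cmulZr scalerA !qZ q_star -/z.
rewrite conjM conjR conjCK [X in _ + X * _]mulrC.
set w := cmod (q (cmul _ _)); have -> : q (cmul (cstar a) a) = w%:C by exact: posC_real.
rewrite rmorphN /=.
have -> : e%:C + - t%:C * z^* * z + - t%:C * z * z^*
   + - t%:C * z^* * (- t%:C * z) * w%:C
  = t%:C ^+ 2 * (z^* * z) * w%:C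
    - 2 * t%:C * (z^* * z) + e%:C by ring.
by rewrite mul_conj -(realcX t) -(realc_nat R 2) -!realcM -realcB -realcD lexx.
Qed.

(** With K = L - i h one has K^* K = L^2 + h^2 = L, so positivity at (1 - K)^* (1 - K) = 1 - L gives
    q L <= e, while q L = q (L^2) + q (h^2) >= q (h^2). *)
Lemma positive_form_small h : cstar h = h -> nrm h <= 2 / 5 ->
  cmod (q (cmul h h)) <= e.
Proof.
move=> hh /(quasi_unitary_part hh)[L [L_sa Lh LE]].
pose K := L - 'i *: h.
have K_star : cstar K = L + 'i *: h.
  by rewrite cstarB cstarZ L_sa hh conjCi scaleNr opprK.
have KK : cmul (cstar K) K = L.
  rewrite K_star /K !cmulE scalerA -expr2 sqrCi scaleN1r opprK Lh -[RHS]LE.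
  by rewrite addrA subrK.
have := q_ge0_1 (- K); rewrite cstarN.
have -> : cmul (- cstar K) (- K) = L.
  by rewrite cmulNl cmulNr opprK.
have -> : e%:C + q (- K) + q (- cstar K) + q L = e%:C - q L.
  rewrite !qN K_star /K !qD qN qZ; set z := q L; ring.
rewrite -{1}LE qD -{1}L_sa => h1.
have hh0 : 0 <= q (cmul h h) by rewrite -{1}hh q_ge0.
rewrite -lecR -posC_real// -subr_ge0; apply: le_trans h1 _.
by rewrite opprD addrA addrAC gerBl q_ge0.
Qed.

Lemma positive_form_sa h : cstar h = h ->
  cmod (q (cmul h h)) <= 7 * nrm h ^+ 2 * e.
Proof.
move=> hh; have e0 := positive_form_e.
have [h0|h0] := eqVneq (nrm h) 0.
  rewrite (nrm_eq0 h0) cmul0l; have -> : q 0 = 0 := linear_zero lq.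
  by rewrite nrm0 expr0n mulr0 mul0r /cmod nrm0.
have {}h0 : 0 < nrm h by rewrite lt_neqAle eq_sym h0 nrm_ge0.
(* Rescaling to norm 2/5 costs the factor 25/4, rounded up to 7; its size is immaterial, as the next
   lemma removes it. *)
pose r := 2 / (5 * nrm h); have r0 : 0 < r by rewrite divr_gt0// mulr_gt0.
have r_ge0 := ltW r0.
have := @positive_form_small (r%:C *: h).
rewrite cstarZ conjR hh nrm_scale cmodC// cmulZl cmulZr scalerA qZ.
rewrite !cmodM cmodC// => /(_ erefl).
have -> : r * nrm h = 2 / 5 by rewrite /r; field; rewrite gt_eqF.
move=> /(_ (lexx _)); rewrite mulrC -ler_pdivlMr => [/le_trans|]; [apply|exact: mulr_gt0].
have -> : e / (r * r) = 25 / 4 * nrm h ^+ 2 * e by rewrite /r; field; rewrite gt_eqF.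
by rewrite ler_wpM2r// ler_wpM2r ?sqr_ge0//; lra.
Qed.

(** Iterating [positive_form_cs] along the squares of [h] bounds the 2^n-th power of the left side,
    and the crude bound applied at level n contributes its factor 7 only once, so [power_le]
    discards it. *)
Lemma positive_form_sa_sharp h : cstar h = h ->
  cmod (q (cmul h h)) <= nrm h ^+ 2 * e.
Proof.
move=> hh; have e0 := positive_form_e.
pose x n := cmod (q (sq n.+1 h)).
have x_sqr n : x n ^+ 2 <= e * x n.+1.
  rewrite /x (le_trans (positive_form_cs _))// sq_sa//.
have x_le n : x n <= 7 * (nrm h ^+ 2) ^+ (2 ^ n) * e.
  rewrite /x /= (le_trans (positive_form_sa (sq_sa n hh)))//.
  by rewrite nrm_sq// -!exprM mulnC.
rewrite -[cmod _]/(x 0%N); have x0 n : 0 <= x n by exact: cmod_ge0.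
have [e_eq0|e_neq0] := eqVneq e 0.
  by have := x_sqr 0%N; rewrite e_eq0 mul0r mulr0 real_exprn_even_le0 ?num_real//= => /eqP ->.
have {}e_neq0 : 0 < e by rewrite lt_neqAle eq_sym e_neq0.
have x_pow n : x 0%N ^+ (2 ^ n) * e <= e ^+ (2 ^ n) * x n.
  elim: n => [|n IH]; first by rewrite !expr1 mulrC.
  have := lerXn2r 2 _ _ IH; rewrite ?nnegrE ?mulr_ge0 ?exprn_ge0//.
  move=> /(_ isT isT); rewrite !exprMn -!exprM -expnSr.
  move=> /le_trans/(_ (ler_wpM2l _ (x_sqr n))); rewrite exprn_ge0// => /(_ isT).
  by move=> h1; rewrite -(ler_pM2r e_neq0) -mulrA -expr2 -mulrA [x _ * e]mulrC.
apply: (@power_le _ _ _ 7) => // [|n]; first by rewrite mulr_ge0 ?sqr_ge0.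
rewrite -(ler_pM2r e_neq0) (le_trans (x_pow n))// exprMn.
rewrite (le_trans (ler_wpM2l (exprn_ge0 _ e0) (x_le n)))//.
by rewrite le_eqVlt; apply/orP; left; apply/eqP; ring.
Qed.

Lemma positive_form_le a : cmod (q (cmul (cstar a) a)) <= nrm a ^+ 2 * e.
Proof.
have e0 := positive_form_e; set h := cmul (cstar a) a.
have h_sa : cstar h = h by rewrite /h cstarM cstarK.
rewrite -(@ler_pXn2r _ 2)// ?nnegrE ?cmod_ge0 ?mulr_ge0 ?exprn_ge0 ?nrm_ge0//.
rewrite (le_trans (positive_form_cs _))// h_sa.
rewrite (le_trans (ler_wpM2l e0 (positive_form_sa_sharp h_sa)))//.
by rewrite /h nrm_cstar_mul le_eqVlt; apply/orP; left; apply/eqP; ring.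
Qed.

End PositiveForm.

(** Says that u = 1 - 2 K satisfies u^* u = 1 in the unitization, written without the unit. *)
Definition quasi_unitary (K : A) := K + cstar K = 2 *: cmul (cstar K) K.

Lemma quasi_unitary_isometry K v : quasi_unitary K ->
  nrm (v - 2 *: cmul K v) = nrm v.
Proof.
move=> KK; apply/eqP; rewrite -(@eqrXn2 _ 2) ?nrm_ge0// -!nrm_cstar_mul.
rewrite cstarB cstarZ cstarM conjC_nat !cmulE -!cmulA.
have KK' : cmul (cstar v) (cmul K v) + cmul (cstar v) (cmul (cstar K) v) =
    2 *: cmul (cstar v) (cmul (cstar K) (cmul K v)).
  by rewrite -cmulDr -cmulDl KK cmulZl cmulZr -!cmulA.
rewrite opprK -KK' scalerDr.
by rewrite [2 *: cmul _ _ + 2 *: _]addrC addKr subrK.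
Qed.

(** 1 - K is the average of 1 and the isometry 1 - 2 K. *)
Lemma quasi_unitary_contract K v : quasi_unitary K -> nrm (v - cmul K v) <= nrm v.
Proof.
move=> /(quasi_unitary_isometry v) Kv.
have -> : v - cmul K v = 2^-1 *: (v + (v - 2 *: cmul K v)).
  rewrite addrA scalerBr scalerA mulVf ?pnatr_eq0// scale1r -mulr2n -(scaler_nat 2 v).
  by rewrite scalerA mulVf ?pnatr_eq0// scale1r.
rewrite nrm_half.
by rewrite ler_pdivrMl// (le_trans (nrmD _ _))// Kv mulr_natl mulr2n.
Qed.

(** K K^* is half the difference of K^* and its image under the isometry 1 - 2 K, so |K^*|^2 = |K
    K^*| <= |K^*|. *)
Lemma quasi_unitary_le K : quasi_unitary K -> nrm (cstar K) <= 1.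
Proof.
move=> KK; suff : nrm (cmul K (cstar K)) <= nrm (cstar K).
  rewrite -{1}(cstarK K) nrm_cstar_mul; have := nrm_ge0 (cstar K).
  rewrite le_eqVlt => /predU1P[<- _|K0]; first exact: ler01.
  by rewrite expr2 ger_pMl.
have -> : cmul K (cstar K) = 2^-1 *: (cstar K - (cstar K - 2 *: cmul K (cstar K))).
  by rewrite subKr scalerA mulVf ?pnatr_eq0// scale1r.
rewrite nrm_half.
rewrite ler_pdivrMl// (le_trans (nrmD _ _))// nrmN quasi_unitary_isometry//.
by rewrite mulr_natl mulr2n.
Qed.

Lemma quasi_unitary_factor K w : quasi_unitary K ->
  w - cmul (cmul (cstar K) K) w = w - cmul K w - cmul (cstar K) (w - cmul K w).
Proof.
move=> KK; set P := cmul _ K.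
have PP : cmul (cstar K) w + cmul K w = cmul P w + cmul P w.
  by rewrite -cmulDl addrC KK cmulZl scaler_nat mulr2n.
rewrite cmulBr [cmul (cstar K) (cmul K w)]cmulA -/P opprB addrCA addrC.
rewrite -[w - _ - _]addrA -opprD [cmul K w + _]addrC PP opprD addrCA.
by rewrite -addrA subrK addrC.
Qed.

(* [K = H (H + i)^-1], the quasi-inverse giving the Cayley transform [1 - 2 K]. *)
Definition cayley H K := cmul H K + 'i *: K = H /\
  forall x, cmul x H = cmul H x -> cmul x K = cmul K x.

(** Multiply (H + i) K = H on the left by K^* and eliminate H from the products using the adjoint
    equation K^* (H - i) = H. *)
Lemma cayley_quasi_unitary H K : cstar H = H -> cayley H K -> quasi_unitary K.
Proof.
move=> H_sa [HK _].
have KH : cmul (cstar K) H = H + 'i *: cstar K.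
  have := congr1 cstar HK; rewrite cstarD cstarM cstarZ conjCi H_sa scaleNr.
  by move/eqP; rewrite subr_eq => /eqP.
have HK' : cmul H K = H - 'i *: K by rewrite -[X in X - _]HK addrK.
have := congr1 (cmul (cstar K)) HK.
rewrite cmulDr cmulZr cmulA KH cmulDl HK' cmulZl => e.
apply: (@scalerI _ _ 'i); first exact: neq0Ci.
apply: (addrI H); rewrite scalerDr addrCA -e -!addrA addrCA addNKr.
by rewrite -mulr2n -scaler_nat scalerA mulrC -scalerA.
Qed.

Lemma cayley_comm_star H K : cstar H = H -> cayley H K ->
  cmul (cstar K) K = cmul K (cstar K).
Proof.
move=> H_sa [_ Kcomm]; apply: (Kcomm).
by have := congr1 cstar (Kcomm H erefl); rewrite !cstarM H_sa.
Qed.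

(** A Neumann series: the equation is the fixed-point equation K = -i (H - H K). *)
Lemma cayley_small H : nrm H < 1 -> exists K, cayley H K.
Proof.
move=> H1; pose U := [set K : A | forall x, cmul x H = cmul H x -> cmul x K = cmul K x].
have q01 : 0 <= nrm H < 1 by rewrite nrm_ge0.
have [||||K UK KE] := @contraction_fixpoint (fun K => - 'i *: (H - cmul H K)) U _ q01.
- by move=> x _; rewrite cmul0l cmul0r.
- move=> K /closure_tends[u Uu uK] x xH.
  apply: (tends_unique (tends_cmul (tends_cst x) uK)).
  have -> : (fun n => cmul x (u n)) = (fun n => cmul (u n) x).
    by apply/funext => n; exact: Uu.
  exact: tends_cmul uK (tends_cst x).
- move=> K UK x xH; rewrite !cmulE xH cmulA xH -!cmulA.
  by rewrite (UK x xH).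
- move=> x y _ _; rewrite -scalerBr nrm_scale opprB addrC addrA subrK.
  have -> : cmod (- 'i : R[i]) = 1.
    by apply: complexI; rewrite -cmodE normrN normCi.
  by rewrite mul1r -cmulBr (nrmC x) nrm_cmul.
exists K; split => //.
rewrite -{2}KE scalerA mulrN -expr2 sqrCi opprK scale1r.
by rewrite addrC subrK.
Qed.

(** The equation for c H reads (H + i / c) K' = H, that is (H + i) K' = H + i d K' with d = 1 - 1 /
    c. Since i (H + i)^-1 = 1 - K, it becomes K' = K + d (K' - K K'), a contraction because 1 - K
    does not increase norms. *)
Lemma cayley_scale H K (c : R) : cstar H = H -> cayley H K -> 1 <= c ->
  exists K', cayley (c%:C *: H) K'.
Proof.
move=> H_sa HK c1; have KK := cayley_quasi_unitary H_sa HK.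
case: HK => HK Kcomm; have c0 : 0 < c by exact: lt_le_trans c1.
have c_neq0 : c%:C != 0 by rewrite -[0]/(0%:C) (inj_eq (@complexI R)) gt_eqF.
pose d := 1 - c^-1; have d0 : 0 <= d by rewrite subr_ge0 invf_le1.
have d01 : 0 <= d < 1 by rewrite d0 gtrBl invr_gt0.
pose U := [set K : A | forall x, cmul x H = cmul H x -> cmul x K = cmul K x].
have [||||K' UK K'E] :=
  @contraction_fixpoint (fun v => K + d%:C *: (v - cmul K v)) U d d01.
- by move=> x _; rewrite cmul0l cmul0r.
- move=> v /closure_tends[u Uu uv] x xH.
  apply: (tends_unique (tends_cmul (tends_cst x) uv)).
  have -> : (fun n => cmul x (u n)) = (fun n => cmul (u n) x).
    by apply/funext => n; exact: Uu.
  exact: tends_cmul uv (tends_cst x).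
- move=> v Uv x xH; rewrite !cmulE cmulA (Kcomm x xH) (Uv x xH) -!cmulA.
  by rewrite (Uv x xH).
- move=> x y _ _; rewrite opprD addrACA subrr add0r -scalerBr nrm_scale cmodC//.
  rewrite ler_wpM2l//; have -> : x - cmul K x - (y - cmul K y) = x - y - cmul K (x - y).
    by rewrite cmulBr !opprD addrACA.
  exact: quasi_unitary_contract.
exists K'; split; last first.
  move=> x; rewrite cmulZl cmulZr => /(scalerI c_neq0); exact: UK.
have HKv v : cmul H (v - cmul K v) = 'i *: cmul K v.
  by rewrite cmulBr cmulA -cmulBl -{1}HK addrC addKr cmulZl.
have e : cmul H K' + 'i *: K' = H + (d%:C * 'i) *: K'.
  rewrite -{1 2}K'E cmulDr cmulZr HKv scalerDr addrACA HK; congr (_ + _).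
  rewrite scalerA [_ * 'i]mulrC -scalerA -scalerDr -mulrC -scalerA -scalerDr.
  by rewrite [cmul K K' + _]addrC subrK !scalerA mulrC.
have cE : c^-1%:C = 1 - d%:C by rewrite -realcB /d subKr.
rewrite cmulZl; transitivity (c%:C *: (cmul H K' + (c^-1%:C * 'i) *: K')).
  by rewrite scalerDr !scalerA mulrA fmorphV mulfV// mul1r.
by rewrite cE mulrBl mul1r scalerBl addrA e addrK.
Qed.

Lemma cayley_ex H : cstar H = H -> exists K, cayley H K.
Proof.
move=> H_sa; pose c := 1 + nrm H; have c0 : 0 < c by rewrite ltr_pwDl ?nrm_ge0.
have c_neq0 : c%:C != 0 by rewrite -[0]/(0%:C) (inj_eq (@complexI R)) gt_eqF.
have H'_sa : cstar (c^-1%:C *: H) = c^-1%:C *: H by rewrite cstarZ conjR H_sa.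
have [|K HK] := @cayley_small (c^-1%:C *: H).
  by rewrite nrm_scale cmodC ?invr_ge0 ?(ltW c0)// ltr_pdivrMl// mulr1 ltrDr.
have [|K' HK'] := cayley_scale H'_sa HK (c := c); first by rewrite lerDl nrm_ge0.
by exists K'; move: HK'; rewrite scalerA fmorphV mulfV// scale1r.
Qed.

(* With [P = K^* K = H^2 (1 + H^2)^-1] and [H = sq n b], raising [b (1 - P)] to the
   power [2 ^ n] gives [H (1 - P) ^ (2 ^ n)], and [H (1 - P)] is a contraction. *)
Lemma cayley_cutoff n b K : cstar b = b -> cayley (sq n b) K ->
  nrm (b - cmul (cmul (cstar K) K) b) <= 1.
Proof.
move=> b_sa HK; have H_sa := sq_sa n b_sa.
have KK := cayley_quasi_unitary H_sa HK; have Kn := cayley_comm_star H_sa HK.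
set P := cmul (cstar K) K; pose E v := v - cmul P v.
have K'K' : quasi_unitary (cstar K) by rewrite /quasi_unitary cstarK addrC KK -Kn.
have EE w : E w = w - cmul K w - cmul (cstar K) (w - cmul K w).
  exact: quasi_unitary_factor.
have E_le v : nrm (E v) <= nrm v.
  by rewrite EE (le_trans (quasi_unitary_contract _ K'K'))// quasi_unitary_contract.
have bK : cmul b K = cmul K b by case: (HK) => _; apply; rewrite sq_comm.
have bK' : cmul b (cstar K) = cmul (cstar K) b.
  by rewrite -{1}b_sa -cstarM -bK cstarM b_sa.
have bP : cmul b P = cmul P b by rewrite /P cmulA bK' -cmulA bK cmulA.
have E_l x z m : cmul (iter m E x) z = iter m E (cmul x z).
  by elim: m => //= m IH; rewrite /E cmulBl -cmulA IH.
have E_r x z m : cmul x P = cmul P x -> cmul x (iter m E z) = iter m E (cmul x z).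
  by move=> xP; elim: m => //= m IH; rewrite /E cmulBr IH cmulA xP -cmulA IH.
(* [P] commutes with [b], so the 2^m factors 1 - P can be collected in front of b^(2^m). *)
have E_sq m : sq m (E b) = iter (2 ^ m) E (sq m b).
  elim: m => //= m IH; rewrite IH E_l E_r; last by rewrite sq_comm.
  by rewrite -iterD addnn -mul2n expnS.
have y_sa : cstar (E b) = E b by rewrite /E cstarB !cstarM cstarK b_sa -/P bP.
rewrite -(@expr_le1 _ (2 ^ n)) ?expn_gt0 ?nrm_ge0// -nrm_sq// E_sq.
(* 1 - P is the product of 1 - [cstar K], a contraction, and 1 - [K]; and (1 - K) H = i K has norm
   at most 1. *)
have EH : nrm (E (sq n b)) <= 1.
  rewrite EE (le_trans (quasi_unitary_contract _ K'K'))//.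
  have -> : sq n b - cmul K (sq n b) = 'i *: K.
    case: HK => HK Kcomm; rewrite -(Kcomm _ erefl) -{1}HK addrC addKr//.
  rewrite nrm_scale; have -> : cmod ('i : R[i]) = 1.
    by apply: complexI; rewrite -cmodE normCi.
  by rewrite mul1r -nrm_cstar quasi_unitary_le.
(* As 2^n is positive, one factor 1 - P is available for H; the others do not increase norms. *)
case: (2 ^ n)%N (expn_gt0 2 n) => // m _; rewrite iterSr.
by apply: le_trans EH; elim: m => //= m IH; exact: le_trans (E_le _) IH.
Qed.

End CStarAlgebras.

(** * Hilbert space completion of a semi-inner product *)

Section Completion.
Variables (R : realType) (V : semi_inner R).
Implicit Types (u v : V) (M : R).

Definition bounds (f : V -> R[i]^o) M :=
  0 <= M /\ forall v, cmod (f v) <= M * seminorm v.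

(** Limits in this sense inherit conjugate linearity, and a null vector of [V] gives the zero
    functional, so the completion is a subspace of functions and no quotient is formed. *)
Definition approximable : {pred V -> R[i]^o} :=
  [pred f | `[< forall e : R, 0 < e -> exists u, bounds (fun v => f v - sip v u) e >]].

(* The completion of [V], realized inside its antidual as the set of functionals
   that are limits of functionals [sip _ u]. *)
Record completion := Completion {
  compl_fun :> V -> R[i]^o;
  complP : compl_fun \in approximable
}.

HB.instance Definition _ := [isSub of completion for compl_fun].
HB.instance Definition _ := [Choice of completion by <:].

Lemma boundsD f g M N : bounds f M -> bounds g N -> bounds (fun v => f v + g v) (M + N).
Proof.
move=> [M0 fM] [N0 gN]; split=> [|v]; first exact: addr_ge0.
by rewrite mulrDl (le_trans (cmodD _ _))// lerD.
Qed.

Lemma boundsZ k f M : bounds f M -> bounds (fun v => k * f v) (cmod k * M).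
Proof.
move=> [M0 fM]; split=> [|v]; first by rewrite mulr_ge0 ?cmod_ge0.
by rewrite cmodM -mulrA ler_wpM2l ?cmod_ge0.
Qed.

Lemma bounds_le f M N : bounds f M -> M <= N -> bounds f N.
Proof.
move=> [M0 fM] MN; split=> [|v]; first exact: le_trans MN.
by rewrite (le_trans (fM v))// ler_wpM2r ?seminorm_ge0.
Qed.

Lemma bounds_sip u : bounds (fun v => sip v u) (seminorm u).
Proof.
split=> [|v]; first exact: seminorm_ge0.
by rewrite mulrC cauchy_schwarz.
Qed.

Lemma approximable_closed : submod_closed approximable.
Proof.
split=> [|k f g /asboolP fA /asboolP gA]; apply/asboolP => e e0.
  exists (si_zero V); split=> [|v]; first exact: ltW.
  by rewrite sip_zeror subrr /cmod nrm0 mulr_ge0 ?seminorm_ge0 ?ltW.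
have e1 : 0 < e / 2 / (cmod k + 1).
  by rewrite !divr_gt0// ltr_wpDl ?cmod_ge0.
have [u fu] := fA _ e1; have [w gw] := gA (e / 2) (divr_gt0 e0 (ltr0Sn _ _)).
exists (si_add (si_scale k u) w).
have -> : (fun v => (k *: f + g) v - sip v (si_add (si_scale k u) w)) =
    fun v => k * (f v - sip v u) + (g v - sip v w).
  by apply/funext => v; rewrite sip_addr sip_scaler mulrBr opprD addrACA.
apply: bounds_le (boundsD (boundsZ k fu) gw) _.
suff : cmod k * (e / 2 / (cmod k + 1)) <= e / 2 by lra.
rewrite mulrA ler_pdivrMr ?ltr_wpDl ?cmod_ge0// mulrC ler_pM2l ?divr_gt0//.
by rewrite lerDl.
Qed.

HB.instance Definition _ := GRing.isSubmodClosed.Build R[i] (V -> R[i]^o)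
  approximable approximable_closed.
HB.instance Definition _ := [SubChoice_isSubLmodule of completion by <:].

Implicit Types (f g h : completion).

Lemma compl_ext f g : f =1 g -> f = g.
Proof. by move=> fg; apply: val_inj; apply/funext. Qed.

Lemma compl_bounds_ex f : exists M, bounds f M.
Proof.
have /asboolP/(_ 1 ltr01)[u fu] := complP f.
exists (1 + seminorm u).
have -> : compl_fun f = fun v => (f v - sip v u) + sip v u.
  by apply/funext => v; rewrite subrK.
exact: boundsD fu (bounds_sip u).
Qed.

Definition compl_norm f : R := inf [set M | bounds f M].

Lemma compl_norm_has_inf f : has_inf [set M | bounds f M].
Proof.
by split; [have [M] := compl_bounds_ex f; exists M|exists 0 => M []].
Qed.

Lemma compl_norm_le f M : bounds f M -> compl_norm f <= M.
Proof. by move=> fM; apply: ge_inf => //; case: (compl_norm_has_inf f). Qed.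

Lemma compl_norm_ge0 f : 0 <= compl_norm f.
Proof.
by apply: lb_le_inf; [case: (compl_norm_has_inf f)|move=> M []].
Qed.

Lemma bounds_compl_norm f : bounds f (compl_norm f).
Proof.
split=> [|v]; first exact: compl_norm_ge0.
have [v0|v0] := eqVneq (seminorm v) 0.
  by have [M [_ /(_ v)]] := compl_bounds_ex f; rewrite v0 !mulr0.
have {}v0 : 0 < seminorm v by rewrite lt_neqAle eq_sym v0 seminorm_ge0.
rewrite -ler_pdivrMr//; apply: lb_le_inf; first by case: (compl_norm_has_inf f).
by move=> M [_ fM]; rewrite ler_pdivrMr.
Qed.

Lemma compl_normD f g : (compl_norm (f + g))%:C <= (compl_norm f)%:C + (compl_norm g)%:C.
Proof.
by rewrite -realcD lecR; apply/compl_norm_le/boundsD; exact: bounds_compl_norm.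
Qed.

Lemma compl_normZ_le k f : compl_norm (k *: f) <= cmod k * compl_norm f.
Proof. by apply/compl_norm_le/boundsZ; exact: bounds_compl_norm. Qed.

Lemma compl_normZ k f : (compl_norm (k *: f))%:C = `|k| * (compl_norm f)%:C.
Proof.
rewrite cmodE -realcM; congr (_%:C); apply/eqP; rewrite eq_le compl_normZ_le andTb.
have [->|k0] := eqVneq k 0; first by rewrite /cmod nrm0 mul0r compl_norm_ge0.
have ck0 : 0 < cmod k by rewrite -ltcR -cmodE normr_gt0.
rewrite -ler_pdivlMl//; have := compl_normZ_le k^-1 (k *: f).
rewrite scalerA mulVf// scale1r => /le_trans; apply.
suff -> : cmod k^-1 = (cmod k)^-1 by [].
by apply: complexI; rewrite fmorphV /= -!cmodE normfV.
Qed.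

Lemma compl_norm_eq0 f : (compl_norm f)%:C = 0 -> f = 0.
Proof.
move=> /complexI f0; apply: compl_ext => v; apply: cmod_eq0.
have [_ /(_ v)] := bounds_compl_norm f; rewrite f0 mul0r => fv.
by apply/eqP; rewrite eq_le cmod_ge0 andbT.
Qed.

HB.instance Definition _ :=
  Lmodule_isNormed.Build R[i] completion compl_normD compl_normZ compl_norm_eq0.

Lemma nrm_compl f : nrm f = compl_norm f.
Proof. by []. Qed.

Lemma embed_subproof u : (fun v => sip v u : R[i]^o) \in approximable.
Proof.
apply/asboolP => e e0; exists u; split=> [|v]; first exact: ltW.
by rewrite subrr /cmod nrm0 mulr_ge0 ?seminorm_ge0 ?ltW.
Qed.

Definition embed u := Completion (embed_subproof u).

Lemma embedD u v : embed (si_add u v) = embed u + embed v.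
Proof. by apply: compl_ext => w; exact: sip_addr. Qed.

Lemma embedZ k u : embed (si_scale k u) = k *: embed u.
Proof. by apply: compl_ext => w; exact: sip_scaler. Qed.

Lemma nrm_embed u : nrm (embed u) = seminorm u.
Proof.
rewrite nrm_compl; apply/eqP; rewrite eq_le (@compl_norm_le (embed u) _ (bounds_sip u)) andTb.
have [u0|u0] := eqVneq (seminorm u) 0; first by rewrite u0 compl_norm_ge0.
have {}u0 : 0 < seminorm u by rewrite lt_neqAle eq_sym u0 seminorm_ge0.
rewrite -(ler_pM2r u0) -expr2 seminorm_sqr.
by have [_ /(_ u)] := bounds_compl_norm (embed u).
Qed.

Lemma embed_dense f (e : R) : 0 < e -> exists u, nrm (f - embed u) <= e.
Proof.
have /asboolP fA := complP f => /fA[u fu]; exists u.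
by rewrite nrm_compl; apply: compl_norm_le; exact: fu.
Qed.

Lemma embed_tends f : exists u : nat -> V, tends (embed \o u) f.
Proof.
have /choice[u uP] n : exists u, nrm (f - embed u) <= n.+1%:R^-1.
  by apply: embed_dense; rewrite invr_gt0.
exists u; apply: (@tends_le _ _ (fun n => n.+1%:R^-1)); last exact: cvg_inv0.
by move=> n /=; rewrite nrmC.
Qed.

End Completion.

Lemma complex_cauchy (R : realType) (z : nat -> R[i]) (e : nat -> R) :
  (forall m n, (m <= n)%N -> cmod (z n - z m) <= e m) -> e @ \oo --> 0 ->
  exists l, forall m, cmod (l - z m) <= 2 * e m.
Proof.
move=> ze e0.
have real_lim (g : nat -> R) : (forall m n, (m <= n)%N -> `|g n - g m| <= e m) ->
    exists l, forall m, `|l - g m| <= e m.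
  move=> ge; have : cvgn g.
    apply/cauchy_cvgP/cauchy_exP => d d0.
    have /cvgrPdist_lt/(_ d d0)[N _ eN] := e0.
    exists (g N), N => // n /= Nn; rewrite /ball/= distrC (le_lt_trans (ge _ _ Nn))//.
    have := eN N (leqnn _); rewrite /= sub0r normrN; apply: le_lt_trans.
    exact: ler_norm.
  move=> gl; exists (limn g) => m.
  apply: (cvgr_to_le (cvg_norm (cvgB gl (cvg_cst (g m))))).
  by exists m => // n /= mn; exact: ge.
have [m n mn|a aP] := real_lim (fun n => complex.Re (z n)).
  apply: le_trans (ze _ _ mn).
  by rewrite -raddfB -lecR -cmodE; exact: normc_ge_Re.
have [m n mn|b bP] := real_lim (fun n => complex.Im (z n)).
  apply: le_trans (ze _ _ mn).
  rewrite -raddfB; have -> : cmod (z n - z m) = Num.sqrt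
      (complex.Re (z n - z m) ^+ 2 + complex.Im (z n - z m) ^+ 2).
    by apply: complexI; rewrite -cmodE normc_def.
  by rewrite -sqrtr_sqr ler_wsqrtr// lerDr sqr_ge0.
exists (a +i* b) => m.
have -> : a +i* b - z m = (a - complex.Re (z m))%:C + 'i * (b - complex.Im (z m))%:C.
  by case: (z m) => c d; apply/eqP; rewrite eq_complex /=; apply/andP; split; apply/eqP; ring.
have cmod_real (x : R) : cmod x%:C = `|x|.
  apply: complexI; rewrite -cmodE; apply/eqP; rewrite eq_complex /=.
  by rewrite expr0n addr0 sqrtr_sqr !eqxx.
have cmod_i : cmod ('i : R[i]) = 1 by apply: complexI; rewrite -cmodE normCi.
rewrite (le_trans (cmodD _ _))// cmodM cmod_i mul1r !cmod_real.
by rewrite mulr_natl mulr2n lerD.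
Qed.

(** Passes from Cauchy filters to sequences in a dense image. The [g n] have a neighbourhood of
    radius [p n] in the filter, the [u n] approximate them; this costs 4 p m between terms and 8 + 1
    + 1 = 10 times p N at the end. *)
Lemma dense_cauchy_cvg (R : realType) (H : normedModType R[i]) (V : Type) (embed : V -> H) :
  (forall f (e : R), 0 < e -> exists u, nrm (f - embed u) <= e) ->
  (forall (u : nat -> V) (e : nat -> R),
    (forall m n, (m <= n)%N -> nrm (embed (u n) - embed (u m)) <= e m) ->
    e @ \oo --> 0 -> exists f, forall n, nrm (f - embed (u n)) <= 2 * e n) ->
  forall F : set_system H, ProperFilter F -> cauchy F -> cvg F.
Proof.
move=> embed_dense seq_cvg F PF /cauchyP FC.
have [p [p_gt0 p_le p_lim]] : exists p : nat -> R, [/\ forall n, 0 < p n,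
    forall m n, (m <= n)%N -> p n <= p m & p @ \oo --> 0].
  exists (fun n => n.+1%:R^-1); split; last exact: cvg_inv0.
    by move=> n; rewrite invr_gt0.
  by move=> m n mn; rewrite lef_pV2 ?posrE// ler_nat.
have /choice[g gP] n : exists f : H, F [set h : H | nrm (f - h) < p n].
  have [|f Ff] := FC (p n)%:C; first by rewrite ltcR.
  exists f; apply: filterS Ff => h; by move/nrm_ball.
have /choice[u uP] n : exists u, nrm (g n - embed u) <= p n by exact: embed_dense.
have gg m n : (m <= n)%N -> nrm (g n - g m) <= 2 * p m.
  move=> mn; have [h [/= h1 h2]] := filter_ex (filterI (gP m) (gP n)).
  rewrite (le_trans (nrm_triangle h _ _))// [nrm (h - _)]nrmC.
  by have := p_le _ _ mn; lra.
have uu m n : (m <= n)%N -> nrm (embed (u n) - embed (u m)) <= 4 * p m.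
  move=> mn.
  rewrite (le_trans (nrm_triangle (g n) _ _))//.
  have := nrm_triangle (g m) (g n) (embed (u m)).
  have := p_le _ _ mn; have := gg _ _ mn; have := uP n; have := uP m.
  by rewrite [nrm (embed _ - g _)]nrmC; lra.
have [f fP] := seq_cvg _ _ uu (cvgMl0 4 p_lim).
apply/cvg_ex; exists f; apply/cvg_ballP => _ /posC_ex[e e0 ->].
have /cvgrPdist_lt/(_ e e0)[N _ /(_ N (leqnn _))/=] := cvgMl0 10 p_lim.
have pN := p_gt0 N; rewrite sub0r normrN ger0_norm; last by rewrite mulr_ge0// ltW.
move=> eN; apply: filterS (gP N) => h /= gh; apply/nrm_ball.
rewrite (le_lt_trans (nrm_triangle (embed (u N)) _ _))//.
have := nrm_triangle (g N) (embed (u N)) h; have := uP N; have := fP N.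
by rewrite [nrm (embed _ - g _)]nrmC; lra.
Qed.

Section CompletionHilbert.
Variables (R : realType) (V : semi_inner R).
Local Notation H := (completion V).

Lemma completion_cauchy_seq (u : nat -> V) (e : nat -> R) :
  (forall m n, (m <= n)%N -> bounds (fun v => sip v (u n) - sip v (u m)) (e m)) ->
  e @ \oo --> 0 -> exists f : H, forall n, nrm (f - embed (u n)) <= 2 * e n.
Proof.
move=> ue e0.
have /choice[f fP] (v : V) : exists l : R[i]^o,
    forall m, cmod (l - sip v (u m)) <= 2 * (e m * seminorm v).
  apply: complex_cauchy; first by move=> m n mn; case: (ue m n mn).
  by under eq_fun do rewrite mulrC; exact: cvgMl0.
have e_ge0 n : 0 <= e n by case: (ue n n (leqnn _)).
have fB n : bounds (fun v => f v - sip v (u n)) (2 * e n).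
  by split=> [|v]; [rewrite mulr_ge0|rewrite -mulrA].
have fA : f \in @approximable R V.
  apply/asboolP => d d0.
  have d2 : 0 < d / 2 by rewrite divr_gt0.
  have /cvgrPdist_lt/(_ _ d2)[N _ /(_ N (leqnn _))/=] := e0.
  rewrite sub0r normrN ger0_norm// => eN.
  by exists (u N); apply: bounds_le (fB N) _; lra.
by exists (Completion fA) => n; rewrite nrm_compl; apply: compl_norm_le; exact: fB.
Qed.

Lemma completion_cauchy_cvg (F : set_system H) : ProperFilter F -> cauchy F -> cvg F.
Proof.
move: F; apply: (@dense_cauchy_cvg _ _ _ (@embed R V)) => [f e|u e ue e0].
  exact: embed_dense.
apply: completion_cauchy_seq e0 => m n mn.
exact: bounds_le (bounds_compl_norm _) (ue m n mn).
Qed.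

HB.instance Definition _ := Uniform_isComplete.Build H completion_cauchy_cvg.

(** Polarization, as the extraction of the coefficient of k. An inner product defined through the
    norm is continuous at once, so its laws pass from [V] to the completion by density. *)
Definition polarize (N : R[i] -> R[i]) : R[i] :=
  4^-1 * (N 1 - N (- 1) - 'i * N 'i + 'i * N (- 'i)).

Lemma polarizeE (a s t b : R[i]) :
  polarize (fun k => a + k * s + k^* * t + k^* * k * b) = s.
Proof.
have cN1 : (- 1 : R[i])^* = - 1 by rewrite rmorphN /= conjC1.
have cNi : (- 'i : R[i])^* = 'i by rewrite rmorphN /= conjCi opprK.
rewrite /polarize cN1 cNi conjC1 conjCi.
transitivity (4^-1 * (2 * s + 2 * t - 2 * ('i * 'i) * (s - t))); first by ring.
by rewrite -expr2 sqrCi; field.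
Qed.

Definition compl_dot (f g : H) : R[i] :=
  polarize (fun k => (nrm (f + k *: g) ^+ 2)%:C).

Lemma compl_dot_embed u v : compl_dot (embed u) (embed v) = sip u v.
Proof.
rewrite -[RHS](polarizeE (sip u u) _ (sip v u) (sip v v)); congr polarize.
apply/funext => k; rewrite -embedZ -embedD nrm_embed -sip_self.
by rewrite sip_addr !sip_addl !sip_scaler !sip_scalel; ring.
Qed.

Lemma tends_compl_dot (u v : nat -> H) f g : tends u f -> tends v g ->
  tends (fun n => compl_dot (u n) (v n) : R[i]^o) (compl_dot f g).
Proof.
move=> uf vg.
have N k : tends (fun n => (nrm (u n + k *: v n) ^+ 2)%:C : R[i]^o)
    (nrm (f + k *: g) ^+ 2)%:C.
  apply: cvg_tends_C; have h := tends_nrm (tendsD uf (tendsZ k vg)).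
  by rewrite expr2; under eq_fun do rewrite expr2; exact: cvgM.
apply: tends_mulC; apply: tendsD; last by apply: tends_mulC.
by apply: tendsB; [exact: tendsB|exact: tends_mulC].
Qed.

Lemma compl_dot_linearr (x : H) k y z :
  compl_dot x (k *: y + z) = k * compl_dot x y + compl_dot x z.
Proof.
have [[u ux] [v vy] [w wz]] := And3 (embed_tends x) (embed_tends y) (embed_tends z).
apply: (tends_unique (tends_compl_dot ux (tendsD (tendsZ k vy) wz))).
have -> : (fun n => compl_dot ((@embed _ _ \o u) n)
      (k *: (@embed _ _ \o v) n + (@embed _ _ \o w) n)) =
    (fun n => k * compl_dot (embed (u n)) (embed (v n)) + compl_dot (embed (u n)) (embed (w n))).
  apply/funext => n /=; rewrite -embedZ -embedD !compl_dot_embed.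
  by rewrite sip_addr sip_scaler.
by apply: tendsD; [apply: tends_mulC|]; exact: tends_compl_dot.
Qed.

Lemma compl_dot_sym (x y : H) : compl_dot y x = (compl_dot x y)^*.
Proof.
have [[u ux] [v vy]] := conj (embed_tends x) (embed_tends y).
apply: (tends_unique (tends_compl_dot vy ux)).
have /tendsP xy := tends_compl_dot ux vy; apply/tendsP => e /xy[N xyN].
exists N => n /xyN /=; rewrite !compl_dot_embed sip_sym.
apply: le_lt_trans.
change (cmod (sip (v n) (u n) - (compl_dot x y)^*) <=
  cmod ((sip (v n) (u n))^* - compl_dot x y)).
by rewrite -(cmod_conj (sip _ _ - _)) rmorphB /= conjCK.
Qed.

Lemma compl_dot_norm (x : H) : compl_dot x x = `|x| ^+ 2.
Proof.
have [u ux] := embed_tends x.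
apply: (tends_unique (tends_compl_dot ux ux)).
have -> : (fun n => compl_dot ((@embed _ _ \o u) n) ((@embed _ _ \o u) n)) =
    (fun n => (nrm (embed (u n)) ^+ 2)%:C).
  by apply/funext => n /=; rewrite compl_dot_embed sip_self nrm_embed.
rewrite nrmE -realcX; apply: cvg_tends_C; rewrite expr2.
by under eq_fun do rewrite expr2; apply: cvgM; exact: tends_nrm.
Qed.

HB.instance Definition _ := isHilbert.Build R H compl_dot_linearr compl_dot_sym
  compl_dot_norm.

End CompletionHilbert.

Lemma hilbert_completion (R : realType) (V : semi_inner R) :
  exists (H : hilbertType R) (iota : V -> H),
  [/\ forall u v, iota (si_add u v) = iota u + iota v,
      forall k u, iota (si_scale k u) = k *: iota u,
      forall u v, hdot (iota u) (iota v) = sip u v &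
      forall x, exists u : nat -> V, tends (iota \o u) x].
Proof.
exists (completion V : hilbertType R), (@embed R V); split.
- exact: embedD.
- exact: embedZ.
- exact: compl_dot_embed.
- exact: embed_tends.
Qed.

(** * Hilbert module arithmetic *)

Section HilbertModules.
Variables (R : realType) (B : cstarAlgType R) (X : hilbertModType B).
Implicit Types (x y z : X) (b c : B) (k : R[i]).

Lemma mdotDr x y z : mdot x (y + z) = mdot x y + mdot x z.
Proof. exact: (linear_add (mdot_linearr x)). Qed.

Lemma mdotBr x y z : mdot x (y - z) = mdot x y - mdot x z.
Proof. exact: (linear_sub (mdot_linearr x)). Qed.

Lemma mdotZr k x y : mdot x (k *: y) = k *: mdot x y.
Proof. exact: (linear_scale (mdot_linearr x)). Qed.

Lemma mdot0r x : mdot x 0 = 0.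
Proof. exact: (linear_zero (mdot_linearr x)). Qed.

Lemma mdotDl x y z : mdot (y + z) x = mdot y x + mdot z x.
Proof. by rewrite mdot_sym mdotDr cstarD -!mdot_sym. Qed.

Lemma mdotBl x y z : mdot (y - z) x = mdot y x - mdot z x.
Proof. by rewrite mdot_sym mdotBr cstarB -!mdot_sym. Qed.

Lemma mdotZl k x y : mdot (k *: y) x = k^* *: mdot y x.
Proof. by rewrite mdot_sym mdotZr cstarZ -!mdot_sym. Qed.

Lemma mdot0l x : mdot 0 x = 0.
Proof. by rewrite mdot_sym mdot0r cstar0. Qed.

Lemma mdot_ractl x y b : mdot (ract x b) y = cmul (cstar b) (mdot x y).
Proof. by rewrite mdot_sym mdot_ract cstarM -mdot_sym. Qed.

Lemma mdot_suml I (r : seq I) (F : I -> X) y :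
  mdot (\sum_(i <- r) F i) y = \sum_(i <- r) mdot (F i) y.
Proof.
by elim: r => [|i r IH]; rewrite ?big_nil ?mdot0l// !big_cons mdotDl IH.
Qed.

Lemma nrm_mdot x : nrm (mdot x x) = nrm x ^+ 2.
Proof. by apply: complexI; rewrite realcX -!nrmE mdot_norm. Qed.

End HilbertModules.

(** * Representations of C*-algebras and their contractivity *)

Section Representations.
Variables (R : realType) (A : cstarAlgType R) (H : hilbertType R).
Variables (rho : A -> blin H H) (rhoP : is_repr rho).
Implicit Types (a b : A) (x y : H).

Lemma repr_comb k a b x : rho (k *: a + b) x = k *: rho a x + rho b x.
Proof. by rewrite (repr_linear rhoP). Qed.

Lemma reprD a b x : rho (a + b) x = rho a x + rho b x.
Proof. by rewrite (linear_add (repr_linear rhoP)). Qed.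

Lemma repr0 x : rho 0 x = 0.
Proof. by rewrite (linear_zero (repr_linear rhoP)). Qed.

Lemma repr_sum I (r : seq I) (F : I -> A) x :
  rho (\sum_(i <- r) F i) x = \sum_(i <- r) rho (F i) x.
Proof. by apply: (big_morph (fun a => rho a x) (fun a b => reprD a b x) (repr0 x)). Qed.

Lemma repr_mul a b x : rho (cmul a b) x = rho a (rho b x).
Proof. by rewrite (reprM rhoP). Qed.

Lemma repr_adj a x y : hdot (rho a x) y = hdot x (rho (cstar a) y).
Proof. by rewrite (repr_star rhoP) adjP. Qed.

Lemma repr_form a x : hdot x (rho (cmul (cstar a) a) x) = (nrm (rho a x) ^+ 2)%:C.
Proof. by rewrite repr_mul -repr_adj hdot_self. Qed.

(** The functional <x, rho(.) x> is positive with [e] = |x|^2: positivity at the adjoined unit is |x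
    + rho(b) x|^2 >= 0. *)
Lemma repr_le a x : nrm (rho a x) <= nrm a * nrm x.
Proof.
have h : cmod (hdot x (rho (cmul (cstar a) a) x)) <= nrm a ^+ 2 * nrm x ^+ 2.
  apply: (@positive_form_le _ _ (fun b => hdot x (rho b x) : R[i]^o)).
  - by move=> k b c; rewrite repr_comb hdot_linearr.
  - by move=> b; rewrite -hdot_sym repr_adj.
  - by move=> b; rewrite repr_form lecR sqr_ge0.
  - move=> b; have := hdot_self_ge0 (x + rho b x).
    rewrite hdotDl !hdotDr [hdot x x]hdot_self [hdot (rho b x) (rho b x)]hdot_self.
    by rewrite -repr_form repr_adj !addrA.
move: h; rewrite repr_form cmodC ?sqr_ge0// -exprMn.
by rewrite ler_pXn2r// nnegrE ?mulr_ge0 ?nrm_ge0.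
Qed.

Lemma repr_sq_le n a : nrm (rho (sq n a)) <= nrm (rho a) ^+ (2 ^ n).
Proof.
elim: n => [|n IH]; first by rewrite expr1.
rewrite /= (reprM rhoP) (le_trans (nrm_bcomp _ _))// expnS mul2n -addnn exprD.
by rewrite ler_pM ?nrm_ge0.
Qed.

Lemma repr_quasi_unitary_contract K x : quasi_unitary K -> nrm (x - rho K x) <= nrm x.
Proof.
move=> KK; rewrite -(@ler_pXn2r _ 2)// ?nnegrE ?nrm_ge0// nrm_sqrB.
suff -> : 2 * complex.Re (hdot x (rho K x)) = 2 * nrm (rho K x) ^+ 2.
  by have := sqr_ge0 (nrm (rho K x)); lra.
apply: complexI; rewrite -addConj -hdot_sym repr_adj -hdotDr -reprD KK.
rewrite (linear_scale (repr_linear rhoP)) blinZE hdotZr repr_form.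
by rewrite (realcM 2) realc_nat.
Qed.

(** From i K = a (1 - K), where 1 - K acts as a contraction. The bound involves |rho a| and not |a|,
    so K is small under [rho] even if a is large in the algebra. *)
Lemma repr_cayley_le a K : cstar a = a -> cayley a K -> nrm (rho K) <= nrm (rho a).
Proof.
move=> H_sa HK; have KK := cayley_quasi_unitary H_sa HK.
apply: nrm_blin_le => [|x]; first exact: nrm_ge0.
have e : 'i *: rho K x = rho a (x - rho K x).
  have -> : 'i *: rho K x = rho ('i *: K) x by rewrite (linear_scale (repr_linear rhoP)).
  case: HK => HK _; rewrite linearB /= -repr_mul.
  by rewrite -[X in rho X x - _]HK reprD addrC addKr.
have <- : nrm ('i *: rho K x) = nrm (rho K x).
  rewrite nrm_scale (_ : cmod 'i = 1) ?mul1r//.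
  by apply: complexI; rewrite -cmodE normCi.
rewrite e (le_trans (opnormP _ _))//; apply: ler_wpM2l; first exact: opnorm_ge0.
exact: repr_quasi_unitary_contract.
Qed.

End Representations.

(** * Positivity of the scalar form on formal sums of tensors *)

Section TensorForm.
Variables (R : realType) (B : cstarAlgType R) (X : hilbertModType B).
Variables (H : hilbertType R) (sigma : B -> blin H H) (sigmaP : is_repr sigma).
Implicit Types (l : seq (X * H)).

Definition tensor_form l l' : R[i] :=
  \sum_(p <- l) \sum_(p' <- l') hdot p.2 (sigma (mdot p.1 p'.1) p'.2).

Let hdot_sumr I (r : seq I) (x : H) (F : I -> H) :
  hdot x (\sum_(i <- r) F i) = \sum_(i <- r) hdot x (F i).
Proof. by apply: (big_morph (hdot x) (fun a b => hdotDr x a b) (hdot0r x)). Qed.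

(** The formal sum of the x_i (x) sigma(b_i) h behaves as x (x) h with x the sum of the x_i b_i, and
    [mdot_pos] writes <x, x> as b^* b. *)
Lemma tensor_form_cyclic (h : H) (l : seq (X * B)) :
  0 <= tensor_form [seq (p.1, sigma p.2 h) | p <- l] [seq (p.1, sigma p.2 h) | p <- l].
Proof.
have -> : tensor_form [seq (p.1, sigma p.2 h) | p <- l] [seq (p.1, sigma p.2 h) | p <- l]
    = hdot h (sigma (mdot (\sum_(p <- l) ract p.1 p.2) (\sum_(p <- l) ract p.1 p.2)) h).
  rewrite mdot_suml (repr_sum sigmaP) hdot_sumr /tensor_form big_map.
  apply: eq_bigr => p _; rewrite (linear_sumr (mdot_linearr _)) (repr_sum sigmaP) hdot_sumr.
  rewrite big_map; apply: eq_bigr => p' _ /=.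
  by rewrite mdot_ract mdot_ractl !(repr_mul sigmaP) (repr_adj sigmaP).
have [b ->] := mdot_pos (\sum_(p <- l) ract p.1 p.2).
by rewrite (repr_form sigmaP) lecR sqr_ge0.
Qed.

Lemma tensor_form_closure (h : H) (f : H -> H) l :
  (forall g, closure [set sigma c h | c in setT] (f g)) ->
  0 <= tensor_form [seq (p.1, f p.2) | p <- l] [seq (p.1, f p.2) | p <- l].
Proof.
move=> fK.
have /choice[u uP] g : exists u : nat -> B, tends (fun n => sigma (u n) h) (f g).
  have /closure_tends[v vS vg] := fK g.
  have /choice[u uv] n : exists c, sigma c h = v n by have [c _ <-] := vS n; exists c.
  by exists u; rewrite (_ : (fun n => _) = v)//; apply/funext.
apply: (@tends_ge0 _ (fun n => tensor_form [seq (p.1, sigma (u p.2 n) h) | p <- l]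
    [seq (p.1, sigma (u p.2 n) h) | p <- l])).
  move=> n; have := tensor_form_cyclic h [seq (p.1, u p.2 n) | p <- l].
  by rewrite -map_comp.
rewrite /tensor_form; under eq_fun do rewrite big_map.
rewrite big_map; apply: tends_sum => p; under eq_fun do rewrite big_map.
rewrite big_map; apply: tends_sum => p' /=; apply: tends_hdot => //.
exact: (bounded_tends (blin_is_linear _) (blin_bounded _)).
Qed.

Lemma tensor_form_ge0 l : 0 <= tensor_form l l.
Proof.
move: {2}(size l) (erefl (size l)) => n; elim: n l => [|n IH] [|[x1 h1] l] //=.
  by move=> _; rewrite /tensor_form big_nil.
move=> [sz].
(* The vectors [sigma c h1] already form a subspace, so no span is taken. Both [K] and its
   orthogonal complement are invariant under [sigma]. *)
pose K := closure [set sigma c h1 | c in setT].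
have K0 : K 0 by apply: subset_closure; exists 0 => //; rewrite (repr0 sigmaP).
have KD k y z : K y -> K z -> K (k *: y + z).
  move=> /closure_tends[u uS uy] /closure_tends[v vS vz]; apply/closure_tends.
  exists (fun m => k *: u m + v m); last exact: tendsD (tendsZ _ uy) vz.
  move=> m; have [[c _ <-] [d _ <-]] := (uS m, vS m).
  by exists (k *: c + d) => //; rewrite (repr_comb sigmaP).
have Kcl : closure K `<=` K by rewrite /K -(closure_id _).1//; exact: closed_closure.
have Ksigma c y : K y -> K (sigma c y).
  move=> /closure_tends[u uS uy]; apply/closure_tends.
  exists (sigma c \o u); last exact: (bounded_tends (blin_is_linear _) (blin_bounded _)).
  move=> m /=; have [d _ <-] := uS m.
  by exists (cmul c d) => //; rewrite (repr_mul sigmaP).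
have /choice[P PP] g : exists p, K p /\ forall m, K m -> hdot m (g - p) = 0.
  by have [p Kp pP] := projection_ex g K0 KD Kcl; exists p.
pose Q g := g - P g.
have KQ m g : K m -> hdot m (Q g) = 0 by case: (PP g) => _; exact.
have QK m g : K m -> hdot (Q g) m = 0 by move=> Km; rewrite hdot_sym KQ// conjC0.
have PQ c g g' : hdot (P g) (sigma c (Q g')) = 0.
  have := repr_adj sigmaP (cstar c) (P g) (Q g'); rewrite cstarK => <-.
  by rewrite KQ//; apply: Ksigma; case: (PP g).
have QP c g g' : hdot (Q g) (sigma c (P g')) = 0.
  by rewrite QK//; apply: Ksigma; case: (PP g').
(* If [sigma] is degenerate, [h1] itself may lie outside [K]; but [sigma c (Q h1)] lies in [K] and
   in its complement. *)
have Q0 c : sigma c (Q h1) = 0.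
  have KcQ : K (sigma c (Q h1)).
    rewrite /Q linearB /= addrC -scaleN1r; apply: KD; first by apply: Ksigma; case: (PP h1).
    by apply: subset_closure; exists c.
  apply: nrm_eq0; apply/eqP; rewrite -sqrf_eq0; apply/eqP/complexI.
  by rewrite -hdot_self (repr_adj sigmaP) QK//; exact: Ksigma.
pose lf (f : H -> H) l := [seq (p.1, f p.2) | p <- l].
(* Invariance kills the cross terms. The [P] part is the one-vector case; in the [Q] part the term
   of [h1] vanishes, which leaves a shorter sum for the induction. *)
have split_form s : tensor_form s s =
    tensor_form (lf P s) (lf P s) + tensor_form (lf Q s) (lf Q s).
  rewrite /tensor_form !big_map -big_split; apply: eq_bigr => p _ /=.
  rewrite !big_map -big_split; apply: eq_bigr => p' _ /=.
  have e g : g = P g + Q g by rewrite addrC subrK.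
  rewrite [p.2 in LHS]e [p'.2 in LHS]e linearD /= hdotDl !hdotDr PQ QP.
  by rewrite addr0 add0r.
rewrite split_form addr_ge0//; first by apply: (@tensor_form_closure h1) => g; case: (PP g).
have -> : tensor_form (lf Q ((x1, h1) :: l)) (lf Q ((x1, h1) :: l)) =
    tensor_form (lf Q l) (lf Q l).
  rewrite /tensor_form /= big_cons big1 ?add0r => [|p _] /=; last first.
    have := repr_adj sigmaP (cstar (mdot x1 p.1)) (Q h1) p.2; rewrite cstarK => <-.
    by rewrite Q0 hdot0l.
  by apply: eq_bigr => p _; rewrite big_cons /= Q0 hdot0r add0r.
by apply: IH; rewrite size_map.
Qed.

Lemma tensor_form_sym l l' : tensor_form l' l = (tensor_form l l')^*.
Proof.
rewrite /tensor_form rmorph_sum exchange_big; apply: eq_bigr => p _ /=.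
rewrite rmorph_sum; apply: eq_bigr => p' _ /=.
by rewrite -hdot_sym (repr_adj sigmaP) -mdot_sym.
Qed.

Lemma tensor_form_addr l l1 l2 :
  tensor_form l (l1 ++ l2) = tensor_form l l1 + tensor_form l l2.
Proof. by rewrite /tensor_form -big_split; apply: eq_bigr => p _; rewrite big_cat. Qed.

Lemma tensor_form_scaler k l l' :
  tensor_form l [seq (p.1, k *: p.2) | p <- l'] = k * tensor_form l l'.
Proof.
rewrite /tensor_form mulr_sumr; apply: eq_bigr => p _; rewrite big_map mulr_sumr.
by apply: eq_bigr => p' _ /=; rewrite linearZ hdotZr.
Qed.

Lemma tensor_form_nilr l : tensor_form l [::] = 0.
Proof. by rewrite /tensor_form big1// => p _; rewrite big_nil. Qed.

(* Formal sums of elementary tensors in the algebraic tensor product of [X] and [H]. *)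
Definition tensor_semi_inner : semi_inner R :=
  @SemiInner R (seq (X * H)) [::] cat (fun k => map (fun p => (p.1, k *: p.2)))
    tensor_form tensor_form_nilr tensor_form_addr tensor_form_scaler
    tensor_form_sym tensor_form_ge0.

End TensorForm.

(** * The induced representation of a correspondence *)

Section InducedRepresentation.
Variables (R : realType) (A B : cstarAlgType R) (X : correspondence A B).
Variables (H : hilbertType R) (sigma : B -> blin H H) (sigmaP : is_repr sigma).
Local Notation V := (tensor_semi_inner X sigmaP).
Implicit Types (l : V).

Definition tensor_act (a : A) l : V := [seq (lact a p.1, p.2) | p <- l : seq (X * H)].

Lemma tensor_act_adj a l l' : sip (tensor_act a l) l' = sip l (tensor_act (cstar a) l').
Proof.
rewrite /= /tensor_form big_map; apply: eq_bigr => p _; rewrite big_map.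
by apply: eq_bigr => p' _ /=; rewrite lact_adj.
Qed.

Lemma tensor_act_comb l k a b l' : sip l (tensor_act (k *: a + b) l') =
  k * sip l (tensor_act a l') + sip l (tensor_act b l').
Proof.
rewrite /= /tensor_form mulr_sumr -big_split; apply: eq_bigr => p _ /=.
rewrite !big_map mulr_sumr -big_split; apply: eq_bigr => p' _ /=.
by rewrite lact_linear mdot_linearr (repr_comb sigmaP) hdotDr hdotZr.
Qed.

Lemma tensor_actM a b l : tensor_act (cmul a b) l = tensor_act a (tensor_act b l).
Proof.
rewrite /tensor_act -map_comp; apply: eq_map => p /=.
by rewrite lactM.
Qed.

(** For fixed [l], <l, b l> is a positive functional of b with [e] = |l|^2, so [positive_form_le]
    applies before any completion is taken. *)
Lemma tensor_act_le a l : seminorm (tensor_act a l) <= nrm a * seminorm l.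
Proof.
rewrite -(@ler_pXn2r _ 2)// ?nnegrE ?mulr_ge0 ?seminorm_ge0 ?nrm_ge0//.
rewrite exprMn seminorm_sqr tensor_act_adj -tensor_actM.
apply: (@positive_form_le _ _ (fun b => sip l (tensor_act b l) : R[i]^o)).
- by move=> k b c; exact: tensor_act_comb.
- by move=> b; rewrite -tensor_act_adj; exact: sip_sym.
- by move=> b; rewrite tensor_actM -tensor_act_adj; exact: sip_ge0.
- move=> b; have := sip_ge0 (si_add l (tensor_act b l)).
  rewrite sip_addl !sip_addr -sip_self tensor_act_adj.
  by rewrite tensor_act_adj -tensor_actM !addrA.
Qed.

Lemma induced_corr_repr : exists (H' : hilbertType R) (lam : A -> blin H' H')
  (tau : X -> blin H H'), is_corr_repr lam sigma tau.
Proof.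
have [H' [iota [iotaD iotaZ iota_dot iota_dense]]] := hilbert_completion V.
have iota_ext (W : normedModType R[i]) (f g : blin H' W) :
    (forall l, f (iota l) = g (iota l)) -> f = g.
  move=> fg; apply: blin_ext => x; have [u ux] := iota_dense x.
  have fb (h : blin H' W) := bounded_tends (blin_is_linear h) (blin_bounded h) ux.
  apply: (tends_unique (fb f)); have -> // : f \o (iota \o u) = g \o (iota \o u).
  by apply/funext => n; exact: fg.
have dot_ext x y : (forall l, hdot (iota l) x = hdot (iota l) y) -> x = y.
  move=> xy; apply: hdot_extr => z; have [u uz] := iota_dense z.
  apply: (tends_unique (tends_hdot uz (tends_cst x))).
  have -> : (fun n => hdot ((iota \o u) n) x) = (fun n => hdot ((iota \o u) n) y).
    by apply/funext => n; exact: xy.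
  exact: tends_hdot uz (tends_cst y).
have nrm_iota l : nrm (iota l) = seminorm l.
  apply/eqP; rewrite -(@eqrXn2 _ 2) ?nrm_ge0 ?seminorm_ge0//; apply/eqP/complexI.
  by rewrite -hdot_self iota_dot sip_self.
have iota0 : iota [::] = 0.
  by apply: dot_ext => l; rewrite iota_dot hdot0r; exact: (@sip_zeror _ V).
(* [iota] may identify formal sums, so the action is extended from its graph, with [tensor_act_le]
   as the bound. *)
have /choice[lam lamE] a : exists f : blin H' H', forall l, f (iota l) = iota (tensor_act a l).
  have [||||f [lf fM fG]] := @extend_graph _ H' H'
      [set p | exists l, p = (iota l, iota (tensor_act a l))] (nrm a) (nrm_ge0 a).
  - by exists [::]; rewrite /= iota0.
  - move=> k _ _ [l ->] [l' ->]; exists (si_add (si_scale k l) l').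
    have -> : tensor_act a (si_add (si_scale k l) l') =
        si_add (si_scale k (tensor_act a l)) (tensor_act a l').
      by rewrite /= /tensor_act map_cat -!map_comp.
    by rewrite !iotaD !iotaZ.
  - by move=> _ [l ->] /=; rewrite !nrm_iota tensor_act_le.
  - move=> x e e0; have [u /tendsP/(_ e e0)[N uN]] := iota_dense x.
    exists (iota (u N), iota (tensor_act a (u N))); first by exists (u N).
    by rewrite nrmC; exact: (uN N).
  have [g gE] := blin_ex lf fM; exists g => l; rewrite gE.
  by apply: (fG (iota l, iota (tensor_act a l))); exists l.
have /choice[tau tauE] x : exists f : blin H H', forall h, f h = iota [:: (x, h)].
  (* The bound comes from |x (x) h|^2 = <h, sigma <x, x> h>. *)
  apply: (@blin_ex _ _ _ _ (Num.sqrt (opnorm (sigma (mdot x x))))).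
    move=> k g h; apply: dot_ext => l; rewrite hdotDr hdotZr !iota_dot /= /tensor_form.
    rewrite mulr_sumr -big_split; apply: eq_bigr => p _; rewrite !big_seq1 /=.
    by rewrite linearP hdotDr hdotZr.
  move=> h; rewrite -(@ler_pXn2r _ 2)// ?nnegrE ?mulr_ge0 ?nrm_ge0 ?sqrtr_ge0//.
  rewrite exprMn sqr_sqrtr ?opnorm_ge0// nrm_iota seminorm_sqr /= /tensor_form !big_seq1 /=.
  rewrite (le_trans (hdot_le _ _))// mulrC expr2 mulrA ler_wpM2r ?nrm_ge0//.
  exact: opnormP.
have lam_adj a x y : hdot (lam a x) y = hdot x (lam (cstar a) y).
  have [[u ux] [v vy]] := conj (iota_dense x) (iota_dense y).
  have lb b := bounded_tends (blin_is_linear (lam b)) (blin_bounded (lam b)).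
  apply: (tends_unique (tends_hdot (lb _ _ a ux) vy)).
  have -> : (fun n => hdot ((lam a \o (iota \o u)) n) ((iota \o v) n)) =
      (fun n => hdot ((iota \o u) n) ((lam (cstar a) \o (iota \o v)) n)).
    by apply/funext => n /=; rewrite !lamE !iota_dot tensor_act_adj.
  exact: tends_hdot ux (lb _ _ (cstar a) vy).
exists H', lam, tau; split=> //.
- split=> [k a b|a b|a].
  + apply: iota_ext => l; rewrite blinDE blinZE !lamE; apply: dot_ext => l'.
    by rewrite hdotDr hdotZr !iota_dot tensor_act_comb.
  + by apply: iota_ext => l; rewrite /= !lamE tensor_actM.
  + by apply/esym/adj_unique; exact: lam_adj.
- move=> k x y; apply: blin_ext => h; rewrite blinDE blinZE !tauE.
  apply: dot_ext => l; rewrite hdotDr hdotZr !iota_dot /= /tensor_form.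
  rewrite mulr_sumr -big_split; apply: eq_bigr => p _; rewrite !big_seq1 /=.
  by rewrite mdot_linearr (repr_comb sigmaP) hdotDr hdotZr.
- by move=> a x; apply: blin_ext => h; rewrite /= !tauE lamE.
- move=> x b; apply: blin_ext => h; rewrite /= !tauE.
  apply: dot_ext => l; rewrite !iota_dot /= /tensor_form.
  apply: eq_bigr => p _; rewrite !big_seq1 /=.
  by rewrite mdot_ract (repr_mul sigmaP).
- move=> x y; apply: blin_ext => h; apply: hdot_extr => g; rewrite /= -adjP !tauE.
  by rewrite iota_dot /= /tensor_form !big_seq1.
Qed.

End InducedRepresentation.

(** * Contractivity and kernel of a correspondence representation *)

Section CorrespondenceRepresentations.
Variables (R : realType) (A B : cstarAlgType R) (X : correspondence A B).
Variables (H H' : hilbertType R).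
Variables (lam : A -> blin H' H') (rho : B -> blin H H) (pi : X -> blin H H').
Hypothesis piP : is_corr_repr lam rho pi.
Let rhoP : is_repr rho := corr_repr_right piP.
Implicit Types (x y : X) (g h : H).

Lemma corr_repr_dot x y g h : hdot (pi x g) (pi y h) = hdot g (rho (mdot x y) h).
Proof. by rewrite (corr_repr_mdot piP) /= -adjP. Qed.

Lemma corr_repr_sqr x h : (nrm (pi x h) ^+ 2)%:C = hdot h (rho (mdot x x) h).
Proof. by rewrite -corr_repr_dot hdot_self. Qed.

Lemma corr_repr_nrm_le x : nrm (pi x) <= nrm x.
Proof.
apply: nrm_blin_le; first exact: nrm_ge0.
move=> h; rewrite -(@ler_pXn2r _ 2)// ?nnegrE ?mulr_ge0 ?nrm_ge0//.
rewrite -[leLHS]cmodC ?sqr_ge0// corr_repr_sqr exprMn -nrm_mdot.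
rewrite (le_trans (hdot_le _ _))// mulrC expr2 mulrA ler_wpM2r ?nrm_ge0//.
exact: repr_le.
Qed.

Lemma corr_repr_eq0 x : rho (mdot x x) = 0 <-> pi x = 0.
Proof.
split=> [x0|x0]; last first.
  rewrite (corr_repr_mdot piP) x0; apply: blin_ext => h; apply: hdot_extr => g.
  by rewrite /= -adjP hdot0l hdot0r.
apply: blin_ext => h; apply: nrm_eq0; apply/eqP; rewrite -sqrf_eq0; apply/eqP/complexI.
by rewrite corr_repr_sqr x0 hdot0r.
Qed.

End CorrespondenceRepresentations.

Lemma nrm_adj_le (R : realType) (H K : hilbertType R) (T : blin H K) :
  nrm (adj T) <= nrm T.
Proof.
apply: nrm_blin_le; first exact: nrm_ge0.
move=> k; have [->|k0] := eqVneq (nrm (adj T k)) 0.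
  by rewrite mulr_ge0 ?nrm_ge0.
have {}k0 : 0 < nrm (adj T k) by rewrite lt_neqAle eq_sym k0 nrm_ge0.
rewrite -(ler_pM2r k0) -expr2 -[leLHS]cmodC ?sqr_ge0// -hdot_self -adjP.
rewrite (le_trans (hdot_le _ _))// mulrAC ler_wpM2r ?nrm_ge0//; exact: opnormP.
Qed.

Lemma pow2_small (R : realType) (q e : R) : 0 <= q < 1 -> 0 < e -> exists n, q ^+ (2 ^ n) <= e.
Proof.
move=> /andP[q0 q1] e0.
have : (fun n => q ^+ n) @ \oo --> (0 : R) by apply: cvg_expr; rewrite ger0_norm.
move=> /cvgrPdist_lt/(_ e e0)[N _ /(_ N (leqnn _))/=].
rewrite sub0r normrN ger0_norm ?exprn_ge0// => /ltW qN.
by exists N; apply: le_trans qN; apply: ler_wiXn2l => //; [exact: ltW|exact/ltnW/ltn_expl].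
Qed.

(** * Approximate and exact lifting *)

Section Lifting.
Variables (R : realType) (A B : cstarAlgType R) (X : correspondence A B).
Variables (H H' : hilbertType R).
Variables (lam : A -> blin H' H') (rho : B -> blin H H) (pi : X -> blin H H').
Hypothesis piP : is_corr_repr lam rho pi.
Let rhoP : is_repr rho := corr_repr_right piP.

(* The lift is [t (1 + H^2)^(-1/2)] up to a unitary, with [H] a high power of
   [<t, t> / (r^2 (1 + e))] and [r] the norm of [pi t]: this power is small under
   [rho] and cuts [t] down to norm at most [r (1 + e)]. *)
Lemma approx_lift t (e : R) : 0 < e -> exists t',
  nrm t' <= (1 + e) * nrm (pi t) /\ nrm (pi (t - t')) <= e * nrm (pi t).
Proof.
move=> e0; set r := nrm (pi t).
have [r0|r0] := eqVneq r 0.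
  by exists 0; rewrite subr0 -/r r0 !mulr0 nrm0.
have {}r0 : 0 < r by rewrite lt_neqAle eq_sym r0 nrm_ge0.
have e1_gt0 : 0 < 1 + e by rewrite addr_gt0.
have [r_ge0 e1_ge0] := (ltW r0, ltW e1_gt0).
(* One factor 1 + e of slack on each side: |rho b| <= 1 / (1 + e) < 1, so powers of [b] become small
   under [rho], and still d <= (r (1 + e))^2. *)
pose d := r ^+ 2 * (1 + e); have d0 : 0 < d by rewrite mulr_gt0 ?exprn_gt0.
have d_ge0 := ltW d0.
pose a := mdot t t; pose b := d^-1%:C *: a.
have a_sa : cstar a = a by rewrite /a -mdot_sym.
have b_sa : cstar b = b by rewrite /b cstarZ conjR a_sa.
have [|n qn] := @pow2_small _ (1 + e)^-1 e _ e0.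
  by rewrite invr_ge0 (ltW e1_gt0) invf_lt1// ltrDl e0.
have H_sa := sq_sa n b_sa; have [K HK] := cayley_ex H_sa.
have KK := cayley_quasi_unitary H_sa HK.
have aK : cmul a K = cmul K a.
  case: HK => _; apply; rewrite -sq_comm//.
  by rewrite /b cmulZl cmulZr.
exists (t - ract t K); split.
  rewrite -(@ler_pXn2r _ 2)// ?nnegrE ?mulr_ge0 ?nrm_ge0// -nrm_mdot.
  (* The left side is [a] between 1 - [cstar K] and 1 - [K]; as [a] commutes with [K], the product
     of these two gives 1 - K^* K. *)
  have -> : mdot (t - ract t K) (t - ract t K) = d%:C *: (b - cmul (cmul (cstar K) K) b).
    rewrite /b cmulZr -scalerBr scalerA -realcM mulfV ?gt_eqF// scale1r.
    by rewrite quasi_unitary_factor// mdotBl mdot_ractl !mdotBr !mdot_ract aK.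
  rewrite nrm_scale cmodC// (le_trans (ler_wpM2l d_ge0 (cayley_cutoff b_sa HK)))//.
  by rewrite mulr1 /d exprMn [leRHS]mulrC ler_wpM2l ?sqr_ge0// expr2 ler_peMl// lerDl ltW.
rewrite subKr (corr_repr_ract piP) (le_trans (nrm_bcomp _ _))// mulrC ler_wpM2r ?nrm_ge0//.
rewrite (le_trans (repr_cayley_le rhoP H_sa HK))// (le_trans (repr_sq_le rhoP _ _))//.
apply: le_trans qn; apply: lerXn2r; rewrite ?nnegrE ?nrm_ge0 ?invr_ge0//.
rewrite /b (linear_scale (repr_linear rhoP)) nrm_scale cmodC ?invr_ge0//.
have ra : nrm (rho a) <= r ^+ 2.
  rewrite /a (corr_repr_mdot piP) (le_trans (nrm_bcomp _ _))// expr2.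
  by rewrite ler_wpM2r ?nrm_ge0// nrm_adj_le.
by rewrite ler_pdivrMl// (le_trans ra)// /d mulfK// gt_eqF.
Qed.

End Lifting.

Section ExactLifting.
Variables (R : realType) (V : completeNormedModType R[i]) (W : normedModType R[i]).
Variables (f : V -> W) (M : set W) (N : R).
Hypotheses (lf : linear f) (fN : bounded_by f N)
  (MB : forall w v, M w -> M (w - f v))
  (approx : forall w (e : R), M w -> 0 < e -> e < 1 ->
    exists v, nrm v <= (1 + e) * nrm w /\ nrm (w - f v) <= e * nrm w).

(** The iteration of the open mapping theorem: lift the residual approximately, subtract, repeat.
    Residuals stay in [M] by [MB] and decay like e^n, so the lifts form a geometric series. *)
Lemma iterated_lift w (e : R) : M w -> 0 < e -> e < 1 ->
  exists2 v, f v = w & nrm v <= (1 + e) * nrm w / (1 - e).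
Proof.
move=> Mw e0 e1.
have /choice[g gP] w' : exists v, M w' ->
    nrm v <= (1 + e) * nrm w' /\ nrm (w' - f v) <= e * nrm w'.
  have [Mw'|nMw'] := pselect (M w'); last by exists 0.
  by have [v vP] := approx Mw' e0 e1; exists v.
pose ws n := iter n (fun w' => w' - f (g w')) w.
have Mws n : M (ws n) by elim: n => //= n; exact: MB.
have ws_le n : nrm (ws n) <= e ^+ n * nrm w.
  elim: n => [|n IH]; first by rewrite mul1r.
  have [_ /le_trans -> //] := gP _ (Mws n).
  by rewrite exprS -mulrA ler_wpM2l// ltW.
pose u n := \sum_(i < n) g (ws i).
have fu n : f (u n) = w - ws n.
  elim: n => [|n IH]; first by rewrite /u big_ord0 (linear_zero lf) subrr.
  by rewrite /u big_ord_recr /= (linear_add lf) -/(u n) IH opprB addrA addrAC.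
have e01 : 0 <= e < 1 by rewrite e1 ltW.
have [n|v uv v_le] := @geometric_tends _ _ u ((1 + e) * nrm w) e e01.
  have -> : u n.+1 - u n = g (ws n) by rewrite /u big_ord_recr /= [_ + g _]addrC addrK.
  have [g_le _] := gP _ (Mws n); apply: le_trans g_le _.
  by rewrite -mulrA [nrm w * _]mulrC ler_wpM2l// addr_ge0// ltW.
exists v; last by have := v_le 0%N; rewrite /u big_ord0 subr0 expr0 mulr1.
apply: (tends_unique (bounded_tends lf fN uv)).
have -> : f \o u = fun n => w - ws n by apply/funext => n /=; exact: fu.
apply: (@tends_le _ _ (fun n => nrm w * e ^+ n)).
  by move=> n; rewrite addrAC subrr add0r nrmN mulrC.
by apply: cvgMl0; apply: cvg_expr; rewrite ger0_norm// ltW.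
Qed.

Lemma exact_lift w (e : R) : M w -> 0 < e -> exists2 v, f v = w & nrm v <= nrm w + e.
Proof.
move=> Mw e0; have w0 := nrm_ge0 w.
(* Chosen so that (1 + d) |w| <= (|w| + e) (1 - d), that is d (2 |w| + e) <= e, and so that d <
   1. *)
pose d := e / (2 * nrm w + 2 * e).
have s0 : 0 < 2 * nrm w + 2 * e by lra.
have d0 : 0 < d by rewrite divr_gt0.
have dE : d * (2 * nrm w + 2 * e) = e by rewrite /d mulfVK// gt_eqF.
have d1 : d < 1 by rewrite ltr_pdivrMr//; lra.
have [v fv v_le] := iterated_lift Mw d0 d1.
exists v => //; apply: le_trans v_le _.
by rewrite ler_pdivrMr ?subr_gt0//; nra.
Qed.

Lemma quotient_norm v : bounded_by f 1 -> M (f v) ->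
  nrm (f v) = inf [set nrm (v - z) | z in [set z | f z = 0]].
Proof.
move=> f1 Mfv; set S := [set _ | _ in _].
have S0 : S !=set0 by exists (nrm (v - 0)), 0 => //=; exact: linear_zero.
apply/eqP; rewrite eq_le; apply/andP; split.
  apply: lb_le_inf => // _ [z /= fz <-].
  by rewrite -[f v]subr0 -fz -(linear_sub lf) (le_trans (f1 _))// mul1r.
apply/ler_addgt0Pr => e e0; have [v' fv' v'_le] := exact_lift Mfv e0.
apply: le_trans v'_le; apply: ge_inf; first by exists 0 => _ [z _ <-]; exact: nrm_ge0.
by exists (v - v'); rewrite ?subKr//= (linear_sub lf) fv' subrr.
Qed.

End ExactLifting.

(** Scalar Cauchy-Schwarz for the tensor form at x (x) g and y (x) h. It makes the forms <g, rho <s,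
    t> h> bounded in t, as density arguments require. *)
Lemma repr_mdot_le (R : realType) (B : cstarAlgType R) (X : hilbertModType B)
    (H : hilbertType R) (rho : B -> blin H H) (rhoP : is_repr rho) (x y : X) (g h : H) :
  cmod (hdot g (rho (mdot x y) h)) <= nrm x * nrm g * (nrm y * nrm h).
Proof.
pose V := tensor_semi_inner X rhoP.
have seminorm1 z k : seminorm ([:: (z, k)] : V) <= nrm z * nrm k.
  rewrite -(@ler_pXn2r _ 2)// ?nnegrE ?seminorm_ge0 ?mulr_ge0 ?nrm_ge0//.
  rewrite seminorm_sqr /= /tensor_form !big_seq1 /= (le_trans (hdot_le _ _))//.
  rewrite exprMn -nrm_mdot mulrC expr2 mulrA ler_wpM2r ?nrm_ge0//.
  exact: repr_le.
have := @cauchy_schwarz _ V [:: (x, g)] [:: (y, h)].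
rewrite /= /tensor_form !big_seq1 => /le_trans; apply.
by rewrite ler_pM ?seminorm_ge0.
Qed.

Lemma approx_arith1 (R : realType) (e n p t : R) : 0 <= n -> 0 < e -> e < 1 ->
  p <= (1 + e / 4) * n -> t <= (1 + e / 4) * p -> t <= (1 + e) * n.
Proof.
move=> n0 e0 e1 pn tp; have e4 : 0 <= 1 + e / 4 by lra.
apply: le_trans tp _; apply: le_trans (ler_wpM2l e4 pn) _.
by rewrite mulrA ler_wpM2r//; nra.
Qed.

Lemma approx_arith2 (R : realType) (e n p : R) : 0 <= n -> 0 < e -> e < 1 ->
  p <= (1 + e / 4) * n -> e / 4 * n + e / 4 * p <= e * n.
Proof.
move=> n0 e0 e1 pn; have e4 : 0 <= e / 4 by lra.
apply: le_trans (lerD (lexx _) (ler_wpM2l e4 pn)) _.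
by rewrite mulrA -mulrDl ler_wpM2r//; nra.
Qed.

(** * The representation of the interior tensor product *)

Section InteriorTensor.
Variables (R : realType) (A B C : cstarAlgType R).
Variables (X : correspondence A B) (Y : correspondence B C) (T : interior_tensor X Y).
Variables (H0 H1 H2 : hilbertType R).
Variables (rhoC : C -> blin H0 H0) (lamA : A -> blin H2 H2) (sigB : B -> blin H1 H1).
Variables (tauX : X -> blin H1 H2) (piY : Y -> blin H0 H1).
Hypotheses (tauP : is_corr_repr lamA sigB tauX) (piYP : is_corr_repr sigB rhoC piY).
Let rhoP : is_repr rhoC := corr_repr_right piYP.
Let lamP : is_repr lamA := corr_repr_left tauP.

Local Notation elementary := [set tens T x y | x in [set: X] & y in [set: Y]].
Local Notation products :=
  [set bcomp (tauX x) (piY y) | x in [set: X] & y in [set: Y]].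

(** The graph of the future [pi] on sums of elementary tensors, not yet known to be
    single-valued. *)
Let pairs : set (T * blin H0 H2) := lin_span
  [set (tens T x y, bcomp (tauX x) (piY y)) | x in [set: X] & y in [set: Y]].

(** On generators, [tauX] turns the left side into <piY y g, sigB <x, x'> (piY y' h)>, and [sigB] is
    absorbed by the left action on [Y], which gives the form of [tens_mdot]. The rest is
    sesquilinearity. *)
Lemma pairs_dot p q g h : pairs p -> pairs q ->
  hdot (p.2 g) (q.2 h) = hdot g (rhoC (mdot p.1 q.1) h).
Proof.
move=> Pp Pq; move: p Pp q Pq.
have gen x y x' y' : hdot (bcomp (tauX x) (piY y) g) (bcomp (tauX x') (piY y') h) =
    hdot g (rhoC (mdot (tens T x y) (tens T x' y')) h).
  rewrite /= (corr_repr_dot tauP) tens_mdot -(corr_repr_dot piYP).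
  by rewrite (corr_repr_lact piYP).
apply: lin_span_ind.
- by move=> q _; rewrite mdot0l (repr0 rhoP) hdot0r hdot0l.
- move=> k p p' IHp IHp' q Pq.
  rewrite blinDE blinZE hdotDl hdotZl IHp// IHp'// mdotDl mdotZl.
  by rewrite (repr_comb rhoP) hdotDr hdotZr.
- move=> _ [x _ [y _ <-]]; apply: lin_span_ind.
  + by rewrite mdot0r (repr0 rhoP) hdot0r hdot0r.
  + move=> k q q' IHq IHq'.
    rewrite blinDE blinZE hdotDr hdotZr IHq IHq' mdotDr mdotZr.
    by rewrite (repr_comb rhoP) hdotDr hdotZr.
  + by move=> _ [x' _ [y' _ <-]]; exact: gen.
Qed.

Lemma pairs_le p h : pairs p -> nrm (p.2 h) <= nrm h * nrm p.1.
Proof.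
move=> Pp; rewrite -(@ler_pXn2r _ 2)// ?nnegrE ?mulr_ge0 ?nrm_ge0//.
rewrite -[leLHS]cmodC ?sqr_ge0// -hdot_self pairs_dot// exprMn -nrm_mdot.
rewrite (le_trans (hdot_le _ _))// expr2 -mulrA ler_wpM2l ?nrm_ge0// mulrC.
exact: repr_le.
Qed.

Lemma pairs_fst t : lin_span elementary t -> exists w, pairs (t, w).
Proof.
move: t; apply: lin_span_ind.
- by exists 0; exact: lin_span0.
- by move=> k s t [v sv] [w tw]; exists (k *: v + w); exact: (lin_span_comb k sv tw).
- move=> _ [x _ [y _ <-]]; exists (bcomp (tauX x) (piY y)).
  by apply: lin_span_sub; exists x => //; exists y.
Qed.

Lemma tens_approx t (e : R) : 0 < e ->
  exists2 s, lin_span elementary s & nrm (t - s) < e.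
Proof.
move=> e0; have : closure (lin_span elementary) t by rewrite (tens_dense T).
by move=> /closureP; exact.
Qed.

(** The extension is made for one vector h at a time, with values in the complete space [H2];
    linearity in h and the bound |h| |t| then reassemble the values into operators. *)
Lemma tensor_pi_exists : exists pi : T -> blin H0 H2,
  [/\ linear pi, bounded_by pi 1 &
      forall x y, pi (tens T x y) = bcomp (tauX x) (piY y)].
Proof.
have /choice[f fP] h : exists f : T -> H2, [/\ linear f, bounded_by f (nrm h) &
    forall x y, f (tens T x y) = tauX x (piY y h)].
  have [||||f [lf fh fG]] := @extend_graph _ T H2
      [set q | exists2 p, pairs p & q = (p.1, p.2 h)] (nrm h) (nrm_ge0 h).
  - have [w w0] : exists w, pairs (0, w) by apply: pairs_fst; exact: lin_span0.
    exists (0, w) => //=; congr pair; apply/esym/nrm_le0.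
    by rewrite (le_trans (pairs_le h w0))//= nrm0 mulr0.
  - move=> k _ _ [p Pp ->] [q Pq ->]; exists (k *: p + q) => //.
    exact: lin_span_comb.
  - by move=> _ [p Pp ->]; exact: pairs_le.
  - move=> t e /(tens_approx t)[s /pairs_fst[w sw] ts].
    by exists (s, w h) => //; exists (s, w).
  exists f; split=> // x y.
  apply: (fG (tens T x y, tauX x (piY y h))).
  exists (tens T x y, bcomp (tauX x) (piY y)) => //.
  by apply: lin_span_sub; exists x => //; exists y.
have f_lin k g h t : f (k *: g + h) t = k *: f g t + f h t.
  have [[lg bg eg] [lh bh eh] [lk bk ek]] := And3 (fP g) (fP h) (fP (k *: g + h)).
  move: t; apply: (@dense_eq _ _ _ elementary _ _ _ (cmod k * nrm g + nrm h)
    (tens_dense T) lk _ bk).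
  - move=> c s t; rewrite lg lh !scalerDr !scalerA addrACA (mulrC k).
    by rewrite -!scalerA.
  - move=> t; rewrite (le_trans (nrmD _ _))// nrm_scale mulrDl lerD// -mulrA.
    by rewrite ler_wpM2l ?cmod_ge0.
  - by move=> _ [x _ [y _ <-]]; rewrite ek eg eh !linearP.
have /choice[pi piE] t : exists w : blin H0 H2, forall h, w h = f h t.
  apply: (@blin_ex _ _ _ (fun h => f h t) (nrm t)) => [k g h|h]; first exact: f_lin.
  by rewrite mulrC; case: (fP h).
exists pi; split=> [k s t|t|x y].
- by apply: blin_ext => h; rewrite blinDE blinZE !piE; case: (fP h) => lf _ _; rewrite lf.
- rewrite mul1r; apply: nrm_blin_le => [|h]; first exact: nrm_ge0.
  by rewrite piE mulrC; case: (fP h).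
- by apply: blin_ext => h; rewrite piE; case: (fP h).
Qed.

Section TensorRepresentation.
Variable pi : T -> blin H0 H2.
Hypotheses (lpi : linear pi) (pi1 : bounded_by pi 1)
  (piE : forall x y, pi (tens T x y) = bcomp (tauX x) (piY y)).

Let pi_bounded t h : nrm (pi t h) <= nrm h * nrm t.
Proof.
rewrite mulrC (le_trans (opnormP _ _))// ler_wpM2r ?nrm_ge0//.
by rewrite -[leRHS]mul1r; exact: pi1.
Qed.

Let pi_comb k s t h : pi (k *: s + t) h = k *: pi s h + pi t h.
Proof. by rewrite lpi. Qed.

Let form_linear (s : T) g h : linear (fun t => hdot g (rhoC (mdot s t) h) : R[i]^o).
Proof. by move=> k t t'; rewrite mdot_linearr (repr_comb rhoP) hdot_linearr. Qed.

Let form_bounded (s : T) g h :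
  bounded_by (fun t => hdot g (rhoC (mdot s t) h) : R[i]^o) (nrm s * nrm g * nrm h).
Proof.
by move=> t; apply: le_trans (repr_mdot_le rhoP _ _ _ _) _; rewrite [nrm t * _]mulrC mulrA.
Qed.

Let hdot_pi_linear w h : linear (fun t => hdot w (pi t h) : R[i]^o).
Proof. by move=> k t t'; rewrite lpi hdot_linearr. Qed.

Let hdot_pi_bounded w h : bounded_by (fun t => hdot w (pi t h) : R[i]^o) (nrm w * nrm h).
Proof.
move=> t; apply: le_trans (hdot_le _ _) _; rewrite -mulrA ler_wpM2l ?nrm_ge0//.
Qed.

(** [dense_eq] needs linear maps and the form is conjugate linear on the left, so density is used in
    the right variable only: first with an elementary left entry, then with the two sides exchanged
    by conjugation. *)
Lemma tensor_pi_dot s t g h : hdot (pi s g) (pi t h) = hdot g (rhoC (mdot s t) h).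
Proof.
have elem s' g' t' h' : elementary s' ->
    hdot (pi s' g') (pi t' h') = hdot g' (rhoC (mdot s' t') h').
  move=> [x _ [y _ <-]]; move: t'.
  apply: (@dense_eq _ _ _ elementary _ _ _ _ (tens_dense T) (hdot_pi_linear _ _)
    (form_linear _ _ _) (hdot_pi_bounded _ _) (form_bounded _ _ _)).
  move=> _ [x' _ [y' _ <-]]; rewrite !piE.
  apply: (@pairs_dot (tens T x y, bcomp (tauX x) (piY y))
    (tens T x' y', bcomp (tauX x') (piY y'))).
    by apply: lin_span_sub; exists x => //; exists y.
  by apply: lin_span_sub; exists x' => //; exists y'.
have e : hdot (pi t h) (pi s g) = hdot h (rhoC (mdot t s) g).
  move: s; apply: (@dense_eq _ _ _ elementary _ _ _ _ (tens_dense T) (hdot_pi_linear _ _)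
    (form_linear _ _ _) (hdot_pi_bounded _ _) (form_bounded _ _ _)).
  move=> s /elem elem_s; rewrite hdot_sym elem_s -hdot_sym (repr_adj rhoP).
  by rewrite -mdot_sym.
by rewrite hdot_sym e -hdot_sym (repr_adj rhoP) -mdot_sym.
Qed.

Lemma tensor_pi_ract t c : pi (ract t c) = bcomp (pi t) (rhoC c).
Proof.
apply: blin_ext => h; apply: hdot_extr => w /=; move: t.
apply: (@dense_eq _ _ R[i]^o elementary (fun t => hdot w (pi (ract t c) h))
  (fun t => hdot w (pi t (rhoC c h))) (nrm w * nrm h * nrm c) _ (tens_dense T) _
  (hdot_pi_linear _ _) _ (hdot_pi_bounded _ _)).
- by move=> k s t; rewrite (ract_linearl c) lpi hdot_linearr.
- move=> t; apply: le_trans (hdot_pi_bounded _ _ _) _; rewrite -[leRHS]mulrA; apply: ler_wpM2l.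
    by rewrite mulr_ge0 ?nrm_ge0.
  rewrite -(@ler_pXn2r _ 2)// ?nnegrE ?mulr_ge0 ?nrm_ge0// -nrm_mdot mdot_ractl mdot_ract.
  rewrite (le_trans (nrm_cmul _ _))// nrm_cstar exprMn expr2 -mulrA ler_wpM2l ?nrm_ge0//.
  by rewrite (le_trans (nrm_cmul _ _))// nrm_mdot mulrC.
- by move=> _ [x _ [y _ <-]]; rewrite tens_ract !piE /= (corr_repr_ract piYP).
Qed.

(* No continuity of [lact a] is needed: [w], the difference of the two sides at [h],
   is orthogonal to the range of [pi s] for every [s], and to [lamA a (pi t h)]. *)
Lemma tensor_pi_lact a t : pi (lact a t) = bcomp (lamA a) (pi t).
Proof.
apply: blin_ext => h /=; apply/eqP; rewrite -subr_eq0; apply/eqP.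
set w := _ - _.
have elem_lact x y b g : pi (lact b (tens T x y)) g = lamA b (pi (tens T x y) g).
  by rewrite tens_lact !piE /= (corr_repr_lact tauP).
have zero_lin : linear ((fun=> 0) : T -> R[i]^o).
  by move=> k s s'; rewrite scaler0 addr0.
have zero_bounded : bounded_by ((fun=> 0) : T -> R[i]^o) 0.
  by move=> s; rewrite nrm0 mul0r.
have w_orth s g : hdot w (pi s g) = 0.
  move: s; apply: (@dense_eq _ _ R[i]^o elementary _ (fun=> 0) _ _ (tens_dense T)
    (hdot_pi_linear _ _) zero_lin (hdot_pi_bounded _ _) zero_bounded).
  move=> _ [x _ [y _ <-]]; rewrite hdot_sym /w hdotBr tensor_pi_dot.
  have -> : hdot (pi (tens T x y) g) (lamA a (pi t h)) =
      hdot (pi (lact (cstar a) (tens T x y)) g) (pi t h).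
    by rewrite elem_lact (repr_adj lamP) cstarK.
  by rewrite tensor_pi_dot lact_adj cstarK subrr conjC0.
(* For elementary s, [lamA a (pi s h)] equals [pi (lact a s) h], to which [w_orth] applies; density
   gives the rest. *)
have w_orth' : hdot w (lamA a (pi t h)) = 0.
  move: (t); apply: (@dense_eq _ _ R[i]^o elementary (fun s => hdot w (lamA a (pi s h)))
    (fun=> 0) (nrm w * nrm (lamA a) * nrm h) _ (tens_dense T) _ zero_lin _ zero_bounded).
  - by move=> k s s'; rewrite pi_comb linearP hdot_linearr.
  - move=> s; apply: le_trans (hdot_le _ _) _; rewrite -!mulrA ler_wpM2l ?nrm_ge0//.
    by rewrite (le_trans (opnormP _ _))// ler_wpM2l ?opnorm_ge0.
  - by move=> _ [x _ [y _ <-]]; rewrite -elem_lact w_orth.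
apply: nrm_eq0; apply/eqP; rewrite -sqrf_eq0; apply/eqP/complexI.
by rewrite -hdot_self {2}/w hdotBr w_orth w_orth' subr0.
Qed.

Lemma tensor_pi_corr_repr : is_corr_repr lamA rhoC pi.
Proof.
split=> //; first exact: tensor_pi_lact; first exact: tensor_pi_ract.
move=> s t; apply: blin_ext => h; apply: hdot_extr => g /=.
by rewrite -adjP tensor_pi_dot.
Qed.

End TensorRepresentation.

Section TensorRange.
Variable pi : T -> blin H0 H2.
Hypotheses (piP : is_corr_repr lamA rhoC pi)
  (piE : forall x y, pi (tens T x y) = bcomp (tauX x) (piY y)).
Let lpi : linear pi := corr_repr_linear piP.
Local Notation M := (closure (lin_span products)).

Let pi1 : bounded_by pi 1.
Proof. by move=> t; rewrite mul1r; exact: (corr_repr_nrm_le piP). Qed.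

Lemma tensor_pi_range t : M (pi t).
Proof.
have span_pi s : lin_span elementary s -> lin_span products (pi s).
  move: s; apply: lin_span_ind.
  - by rewrite (linear_zero lpi); exact: lin_span0.
  - by move=> k s s' ps ps'; rewrite lpi; exact: lin_span_comb.
  - move=> _ [x _ [y _ <-]]; rewrite piE.
    by apply: lin_span_sub; exists x => //; exists y.
apply/closureP => e /(tens_approx t)[s /span_pi ps ts].
exists (pi s) => //; rewrite -(linear_sub lpi) (le_lt_trans _ ts)//.
by rewrite -[leRHS]mul1r; exact: pi1.
Qed.

Lemma tensor_pi_lift w : lin_span products w -> exists t, pi t = w.
Proof.
move: w; apply: lin_span_ind.
- by exists 0; exact: linear_zero.
- by move=> k _ _ [s <-] [t <-]; exists (k *: s + t); exact: lpi.
- by move=> _ [x _ [y _ <-]]; exists (tens T x y).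
Qed.

Lemma tensor_pi_approx w (e : R) : M w -> 0 < e -> e < 1 ->
  exists t, nrm t <= (1 + e) * nrm w /\ nrm (w - pi t) <= e * nrm w.
Proof.
move=> Mw e0 e1; have [w0|w0] := eqVneq (nrm w) 0.
  by exists 0; rewrite (linear_zero lpi) subr0 w0 !mulr0 nrm0.
have {}w0 : 0 < nrm w by rewrite lt_neqAle eq_sym w0 nrm_ge0.
(* One quarter of [e] pays for replacing [w] by some [pi s], another for the approximate lift of
   [s]; for e < 1, (1 + e/4)^2 <= 1 + e and e/4 + (e/4) (1 + e/4) <= e. *)
have e4 : 0 < e / 4 by rewrite divr_gt0.
have [_ /tensor_pi_lift[s <-] ws] := (closureP _ _).1 Mw _ (mulr_gt0 e4 w0).
have [t [t_le st]] := approx_lift piP s e4.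
have s_le : nrm (pi s) <= (1 + e / 4) * nrm w.
  have := nrm_triangle w (pi s) 0; rewrite !subr0 [nrm (pi s - w)]nrmC.
  by move=> /le_trans; apply; rewrite mulrDl mul1r addrC lerD2l ltW.
have st' : nrm (pi s - pi t) <= e / 4 * nrm (pi s) by rewrite -(linear_sub lpi).
have tri := nrm_triangle (pi s) w (pi t).
exists t; split; first exact: approx_arith1 (ltW w0) e0 e1 s_le t_le.
apply: le_trans tri _; apply: le_trans (lerD (ltW ws) st') _.
exact: approx_arith2 (ltW w0) e0 e1 s_le.
Qed.

Let MB w t : M w -> M (w - pi t).
Proof.
by move=> Mw; rewrite addrC -scaleN1r; apply: closure_span_comb => //; exact: tensor_pi_range.
Qed.

Lemma tensor_pi_quotient : quotient_isomorphism pi M.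
Proof.
split=> [|t]; last first.
  exact: (quotient_norm lpi pi1 MB tensor_pi_approx pi1 (@tensor_pi_range t)).
apply/seteqP; split=> [_ [t _ <-]|w Mw]; first exact: tensor_pi_range.
have [t tw _] := exact_lift lpi pi1 MB tensor_pi_approx Mw ltr01.
by exists t.
Qed.

Lemma tensor_pi_bij :
  set_bij [set: T] M pi <-> forall t : T, rhoC (mdot t t) = 0 -> t = 0.
Proof.
split=> [[_ inj _] t /(corr_repr_eq0 piP) t0|inj].
  by apply: inj; rewrite ?inE// t0 (linear_zero lpi).
have [rangeE _] := tensor_pi_quotient; split.
- by move=> t _ /=; exact: tensor_pi_range.
- move=> s t _ _ st; apply/eqP; rewrite -subr_eq0; apply/eqP/inj.
  by apply/(corr_repr_eq0 piP); rewrite (linear_sub lpi) st subrr.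
- by move=> w; rewrite -rangeE.
Qed.

(** Faithfulness makes the kernel of [pi] trivial, and the quotient norm is then the norm of [T]. *)
Lemma tensor_pi_isometric : injective rhoC -> isometric pi.
Proof.
move=> inj t; rewrite !nrmE; congr (_%:C).
have [_ ->] := tensor_pi_quotient.
have -> : [set nrm (t - z) | z in [set z | pi z = 0]] = [set nrm t].
  apply/seteqP; split=> [_ [z /= z0 <-]|_ ->]; last first.
    by exists 0; rewrite ?subr0//=; exact: linear_zero.
  suff -> : z = 0 by rewrite subr0.
  apply: nrm_eq0; apply/eqP; rewrite -sqrf_eq0 -nrm_mdot; apply/eqP.
  suff -> : mdot z z = 0 by rewrite nrm0.
  by apply: inj; rewrite (linear_zero (repr_linear rhoP)); apply/(corr_repr_eq0 piP).
by rewrite inf1.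
Qed.

End TensorRange.

End InteriorTensor.

Theorem theorem4p14 (R : realType) (A B C : cstarAlgType R)
    (X : correspondence A B) (Y : correspondence B C)
    (Ynondeg : nondegenerate_corr Y)
    (H0 : hilbertType R) (rhoC : C -> blin H0 H0)
    (rhoC_repr : is_repr rhoC) (rhoC_nondeg : nondegenerate_repr rhoC) :
  (* (1) *)
  (exists (H1 H2 : hilbertType R) (lamA : A -> blin H2 H2)
      (sigB : B -> blin H1 H1) (tauX : X -> blin H1 H2) (piY : Y -> blin H0 H1),
    is_corr_repr lamA sigB tauX /\ is_corr_repr sigB rhoC piY)
  /\
  (forall (T : interior_tensor X Y) (H1 H2 : hilbertType R)
      (lamA : A -> blin H2 H2) (sigB : B -> blin H1 H1)
      (tauX : X -> blin H1 H2) (piY : Y -> blin H0 H1),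
    is_corr_repr lamA sigB tauX -> is_corr_repr sigB rhoC piY ->
    let represents_tensor (pi : T -> blin H0 H2) :=
      (forall x y, pi (tens T x y) = bcomp (tauX x) (piY y)) /\
      is_corr_repr lamA rhoC pi in
    let M : set (blin H0 H2) := closure (lin_span
      [set bcomp (tauX x) (piY y) | x in [set: X] & y in [set: Y]]) in
    (* (2) *)
    (exists pi, represents_tensor pi) /\
    (forall pi, represents_tensor pi ->
      (* (3) *)
      (quotient_isomorphism pi M /\
       (set_bij [set: T] M pi <-> forall t : T, rhoC (mdot t t) = 0 -> t = 0)) /\
      (* (4) *)
      (injective rhoC -> isometric pi))).
Proof.
split=> [|T H1 H2 lamA sigB tauX piY tauP piYP represents_tensor M].
  have [H1 [sigB [piY piYP]]] := induced_corr_repr Y rhoC_repr.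
  have [H2 [lamA [tauX tauP]]] := induced_corr_repr X (corr_repr_left piYP).
  by exists H1, H2, lamA, sigB, tauX, piY.
split=> [|pi [piE piP]].
  have [pi [lpi pi1 piE]] := tensor_pi_exists T tauP piYP.
  by exists pi; split=> //; exact: (tensor_pi_corr_repr tauP piYP lpi pi1 piE).
split; last exact: (tensor_pi_isometric piYP piP piE).
by split; [exact: (tensor_pi_quotient piP piE)|exact: (tensor_pi_bij piP piE)].
Qed.
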